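(* Let $r\geq 3$, $k$ with $r+1\geq k\geq 4$, and $n\geq 4r+10$ be integers, and let $H$ be a graph on $k$ vertices which contains a tree on $4$ vertices as a subgraph but does not contain a cycle on $3$ vertices. Then $\sigma(K_{r+1}-H,n)=(r-1)(2n-r)-2(n-r)$.
   Context: A sequence $\pi=(d_1,\dots,d_n)$ of non-increasing nonnegative integers is graphic if it is the degree sequence of a simple graph on $n$ vertices (a realization of $\pi$); $\sigma(\pi)=d_1+\cdots+d_n$. For a graph $F$, a graphic sequence $\pi$ is potentially $F$-graphical if some realization of $\pi$ contains $F$ as a subgraph. $\sigma(F,n)$ denotes the minimum even integer $l$ such that every $n$-term graphic sequence $\pi$ with $\sigma(\pi)\geq l$ is potentially $F$-graphical. For a graph $H$ on at most $m$ vertices, regarded as a subgraph of $K_m$, $K_m-H$ is the graph obtained from the complete graph $K_m$ by deleting the edges of $H$. *)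

(* Defs.v *)
From HB Require Import structures.
From mathcomp Require Import all_boot.
From mathcomp Require Import boolp.

Set Implicit Arguments.
Unset Strict Implicit.
Unset Printing Implicit Defensive.

Record sgraph (V : finType) := SGraph {
  adj :> rel V;
  adj_sym : symmetric adj;
  adj_irr : irreflexive adj }.

Definition deg (V : finType) (G : sgraph V) (x : V) : nat := #|[set y | G x y]|.

(* Subgraph in the usual non-induced sense, up to isomorphism. *)
Definition contains (V W : finType) (G : sgraph V) (F : sgraph W) : Prop :=
  exists2 f : W -> V, injective f & forall x y, F x y -> G (f x) (f y).

Definition has_cycle (V : finType) (G : sgraph V) (m : nat) : Prop :=
  exists2 c : seq V, size c = m & ucycle G c.

(* For a symmetric relation every edge is a ucycle of length 2, hence the
   bound 3 <= m. *)
Definition is_tree (V : finType) (G : sgraph V) : Prop :=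
  (forall x y, connect G x y) /\ (forall m, 3 <= m -> ~ has_cycle G m).

Section CompleteMinus.
Variables (k m : nat) (f : 'I_k -> 'I_m) (H : sgraph 'I_k).

Definition complete_minus_adj : rel 'I_m := fun x y =>
  (x != y) && ~~ [exists u, exists v, [&& H u v, f u == x & f v == y]].

Lemma complete_minus_sym : symmetric complete_minus_adj.
Proof.
move=> x y; rewrite /complete_minus_adj eq_sym; congr (_ && ~~ _).
by apply/existsP/existsP => -[u /existsP[v /and3P[uv fu fv]]];
  exists v; apply/existsP; exists u; rewrite adj_sym uv fu fv.
Qed.

Lemma complete_minus_irr : irreflexive complete_minus_adj.
Proof. by move=> x; rewrite /complete_minus_adj eqxx. Qed.

(* K_m - H, where the injection f : 'I_k -> 'I_m places H inside K_m. *)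
Definition complete_minus : sgraph 'I_m :=
  SGraph complete_minus_sym complete_minus_irr.

End CompleteMinus.

Definition degree_seq (n : nat) (G : sgraph 'I_n) : seq nat :=
  sort geq [seq deg G x | x : 'I_n].

Definition realizes (n : nat) (G : sgraph 'I_n) (p : n.-tuple nat) : Prop :=
  degree_seq G = p.

(* Monotonicity of p is not required separately: degree_seq G is sorted. *)
Definition graphic (n : nat) (p : n.-tuple nat) : Prop :=
  exists G : sgraph 'I_n, realizes G p.

Definition potentially (m n : nat) (F : sgraph 'I_m) (p : n.-tuple nat) : Prop :=
  exists2 G : sgraph 'I_n, realizes G p & contains G F.

Definition sigma_bound (m : nat) (F : sgraph 'I_m) (n l : nat) : Prop :=
  forall p : n.-tuple nat, graphic p -> l <= sumn p -> potentially F p.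

Lemma sigma_exists (m : nat) (F : sgraph 'I_m) (n : nat) :
  exists l, ~~ odd l && `[< sigma_bound F n l >].
Proof.
exists (n * n).+1.*2; rewrite odd_double /=; apply/asboolP => p [G Gp].
suff le_p : sumn p <= n * n.
  by move/leq_trans/(_ le_p); rewrite -addnn leqNgt ltn_addr.
rewrite -Gp (perm_sumn (permEl (perm_sort _ _))) sumnE big_map.
rewrite -[X in X * _]card_ord -sum_nat_const big_enum /=.
by apply: leq_sum => x _; rewrite -[leqRHS]card_ord max_card.
Qed.

(* sigma(F, n): the least even l for which sigma_bound holds. *)
Definition sigma (m : nat) (F : sgraph 'I_m) (n : nat) : nat :=
  ex_minn (sigma_exists F n).

(* Main.v *)
Require Import Defs.
From mathcomp Require Import all_boot.
From mathcomp Require Import perm boolp zify.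

(** Lower bound: with t = r - 2, the join of K_t and an edgeless graph is the only
    graph with its degrees, up to the labelling, and three vertices of K_(r+1) - H
    mapped to its independent part would span a triangle of H.

    Upper bound: a tree on four vertices is a star or a path, so K_(r+1) - H lies in
    the join of K_(r-3) with K_3 + K_1 or with P_4 (the complements of the two trees).
    Argue by induction on r - 3. Delete a vertex v of maximal degree, and realize the
    remaining degrees so that they contain the smaller join, placed on a set R. Among
    all realizations and placements choose one in which v has the most neighbours in
    R, and then one in which important roles are played by vertices of large degree.
    If v misses x in R, edge switches show that the neighbours of x outside R and those
    of v are joined to each other and nearly cover all edges, and all degrees outside R
    are at most deg x: there are too few edges, unless x has no neighbour outside R. In
    that case deg x is so small that either the edge count fails again or the roles can
    be redistributed so that v joins in. *)

Set Implicit Arguments.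
Unset Strict Implicit.
Unset Printing Implicit Defensive.

(** When n and t both drop by 1, the threshold 2tn - t(t+1) + 2 drops by exactly 2(n-1), the most
    that deleting one vertex can take from the degree sum. So the hypothesis always passes to the
    smaller graph, and the difficulty is putting [v] back: it returns with its old neighbourhood,
    which need not contain [R], and only degree-preserving changes may repair this. Maximality of
    [v] turns a small degree of [v] into a bound on all degrees.

    The counting around a missed vertex yields a degree sum of at most 7r^2 - 9r + 4, where r is the
    size of [R], while the hypothesis gives about 2rn - r^2. For n about cr the latter is (2c-1)r^2,
    and c = 4 is the slope at which the quadratic terms agree; this is where the bound 4r + 10 on n
    enters.

    The extremal graph lies only 2 below the threshold, so the last counts, which decide how roles
    are redistributed, have almost no slack; one of them is only saved by a single missing edge. *)

Definition same_deg (V : finType) (G G' : sgraph V) := forall x, deg G x = deg G' x.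

Definition epair (V : eqType) (p q a b : V) :=
  (p == a) && (q == b) || (p == b) && (q == a).

Definition clique (V : finType) (G : sgraph V) (C : {set V}) :=
  forall p q, p \in C -> q \in C -> p != q -> G p q.

Lemma cardsCs_sub (V : finType) (W : {set V}) : #|~: W| = #|V| - #|W|.
Proof. by rewrite cardsCs setCK. Qed.

(** * Counting edges *)

Section Arcs.
Variables (V : finType) (G : sgraph V).

(** Ordered pairs are counted, so an edge inside [A] contributes 2 to [arcs A A], and
    [arcs setT setT] is the degree sum. *)
Definition arcs (A B : {set V}) := \sum_(x in A) \sum_(y in B) G x y.

Lemma degE x : deg G x = \sum_y G x y.
Proof. by rewrite /deg -sum1dep_card big_mkcond; apply: eq_bigr => y _; case: (G x y). Qed.

Lemma card_nbrE (B : {set V}) x : #|[set y in B | G x y]| = \sum_(y in B) G x y.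
Proof.
rewrite -sum1dep_card big_mkcondr; apply: eq_bigr => y _.
by case: (G x y).
Qed.

Lemma arcsC A B : arcs A B = arcs B A.
Proof.
rewrite /arcs exchange_big; apply: eq_bigr => y _; apply: eq_bigr => x _.
by rewrite adj_sym.
Qed.

Lemma sum_deg_in (A : {set V}) : \sum_(x in A) deg G x = arcs A setT.
Proof. by apply: eq_bigr => x _; rewrite degE; apply: eq_bigl => y; rewrite inE. Qed.

Lemma sum_deg : \sum_x deg G x = arcs setT setT.
Proof. by rewrite -sum_deg_in; apply: eq_bigl => y; rewrite inE. Qed.

Lemma arcs_splitr (C A B : {set V}) : arcs A B = arcs A (B :&: C) + arcs A (B :\: C).
Proof.
by rewrite /arcs -big_split /=; apply: eq_bigr => x _; rewrite (big_setID C).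
Qed.

Lemma arcs_splitl (C A B : {set V}) : arcs A B = arcs (A :&: C) B + arcs (A :\: C) B.
Proof. by rewrite /arcs (big_setID C). Qed.

Lemma arcs_le (A B : {set V}) m :
  (forall x, x \in A -> #|[set y in B | G x y]| <= m) -> arcs A B <= #|A| * m.
Proof.
move=> le; rewrite -sum_nat_const; apply: leq_sum => x /le.
by rewrite card_nbrE.
Qed.

Lemma arcs_ge (A B : {set V}) m :
  (forall x, x \in A -> m <= #|[set y in B | G x y]|) -> #|A| * m <= arcs A B.
Proof.
move=> le; rewrite -sum_nat_const; apply: leq_sum => x /le.
by rewrite card_nbrE.
Qed.

Lemma card_nbr_lt (A : {set V}) x : x \in A -> #|[set y in A | G x y]| <= #|A|.-1.
Proof.
move=> xA; rewrite (cardsD1 x A) xA /=; apply: subset_leq_card.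
apply/subsetP => y; rewrite !inE => /andP[-> xy].
by rewrite andbT; apply: contraTneq xy => ->; rewrite adj_irr.
Qed.

Lemma arcs_inside (A : {set V}) : arcs A A <= #|A| * #|A|.-1.
Proof. by apply: arcs_le => x; apply: card_nbr_lt. Qed.

(** Each end of the missing edge has one neighbour fewer in [A] than [arcs_inside] allows. *)
Lemma arcs_inside_nonedge (A : {set V}) p q : p \in A -> q \in A -> p != q ->
  ~~ G p q -> arcs A A + 2 <= #|A| * #|A|.-1.
Proof.
move=> pA qA pq npq.
have lt z z' : z \in A -> z' \in A -> z != z' -> ~~ G z z' ->
    (#|[set y in A | G z y]|).+1 <= #|A|.-1.
  move=> zA z'A zz' nzz'; rewrite (cardsD1 z A) zA /=.
  apply: proper_card; apply/properP; split.
    apply/subsetP => y; rewrite !inE => /andP[-> zy].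
    by rewrite andbT; apply: contraTneq zy => ->; rewrite adj_irr.
  by exists z'; rewrite !inE ?(negPf nzz') ?andbF // eq_sym zz' z'A.
(* The two losses enter as indicators of [p] and [q], which makes the bound termwise. *)
have : \sum_(x in A) (#|[set y in A | G x y]| + ((x == p) + (x == q))) <=
    \sum_(x in A) #|A|.-1.
  apply: leq_sum => x xA; case: (eqVneq x p) => [->|xp].
    by rewrite (negPf pq) addn0 addn1; apply: (lt p q).
  case: (eqVneq x q) => [->|xq]; last by rewrite !addn0; apply: card_nbr_lt.
  by rewrite addn1; apply: (lt q p); rewrite // ?(eq_sym q) // adj_sym.
rewrite sum_nat_const; apply: leq_trans.
rewrite big_split /= leq_add //; first by apply: leq_sum => x _; rewrite card_nbrE.
have one z : z \in A -> 1 <= \sum_(i in A) (i == z).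
  by move=> zA; rewrite (bigD1 z) //= eqxx.
by rewrite big_split /= (leq_add (one _ pA) (one _ qA)).
Qed.

(** An arc from [W] to its complement is charged to the degree of its outer end, so the outer
    degrees pay at most twice. *)
Lemma sum_deg_split (W : {set V}) :
  \sum_x deg G x <= arcs W W + 2 * \sum_(x in ~: W) deg G x.
Proof.
rewrite sum_deg sum_deg_in (arcs_splitl W) (arcs_splitr W (setT :&: W)).
rewrite !setTI !setTD arcsC.
rewrite -addnA leq_add2l mul2n -addnn leq_add2r arcsC (arcsC W).
by rewrite [leqRHS](arcs_splitr W) setTI leq_addr.
Qed.

Lemma low_count (W : {set V}) d : (forall z, z \notin W -> deg G z <= d) ->
  \sum_x deg G x <= arcs W W + 2 * (d * (#|V| - #|W|)).
Proof.
move=> le; apply: leq_trans (sum_deg_split W) _; rewrite leq_add2l leq_mul2l /=.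
rewrite mulnC -cardsCs_sub -sum_nat_const; apply: leq_sum => z; rewrite inE; exact: le.
Qed.

Lemma sum_deg_le (W : {set V}) m d : (forall z, deg G z <= m) ->
  (forall z, z \notin W -> deg G z <= d) ->
  \sum_x deg G x <= #|W| * m + (#|V| - #|W|) * d.
Proof.
move=> lem led; rewrite (bigID (mem W)) /= leq_add //.
  by rewrite -sum_nat_const; apply: leq_sum => z _.
rewrite -cardsCs_sub -sum_nat_const.
rewrite [leqRHS](eq_bigl (fun z => z \notin W)); last by move=> z; rewrite inE.
by apply: leq_sum => z; apply: led.
Qed.

Lemma deg_lt x : deg G x <= #|V|.-1.
Proof.
rewrite /deg -cardsT; have := card_nbr_lt (in_setT x).
by congr (_ <= _); apply: eq_card => y; rewrite !inE.
Qed.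

End Arcs.

(** * Switches *)

Section Exchange.
Variables (V : finType) (G : sgraph V).

Section Toggle.
Variable D : rel V.
Hypotheses (D_sym : symmetric D) (D_irr : irreflexive D).

Definition toggle_adj : rel V := fun x y => G x y (+) D x y.

Lemma toggle_sym : symmetric toggle_adj.
Proof. by move=> x y; rewrite /toggle_adj adj_sym D_sym. Qed.

Lemma toggle_irr : irreflexive toggle_adj.
Proof. by move=> x; rewrite /toggle_adj adj_irr D_irr. Qed.

Definition toggle := SGraph toggle_sym toggle_irr.

Lemma deg_toggle x :
  #|[set y | D x y && G x y]| = #|[set y | D x y && ~~ G x y]| ->
  deg toggle x = deg G x.
Proof.
move=> eqD; rewrite /deg -(cardsID [set y | D x y]).
rewrite -[RHS](cardsID [set y | D x y]).
have -> : [set y | toggle x y] :&: [set y | D x y] = [set y | D x y && ~~ G x y].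
  by apply/setP => y; rewrite !inE /= /toggle_adj; case: (D x y); case: (G x y).
have -> : [set y | G x y] :&: [set y | D x y] = [set y | D x y && G x y].
  by apply/setP => y; rewrite !inE andbC.
rewrite eqD; congr (_ + _); apply: eq_card => y.
by rewrite !inE /= /toggle_adj; case: (D x y); case: (G x y).
Qed.

End Toggle.

Variables (x z : V) (P Q : {set V}).
Hypothesis cardPQ : #|P| = #|Q|.
Hypothesis (hP : forall y, y \in P -> [/\ G x y, ~~ G z y & y != z]).
Hypothesis (hQ : forall y, y \in Q -> [/\ G z y, ~~ G x y & y != x]).

Definition exchange_rel : rel V := fun p q =>
  (p \in [set x; z]) && (q \in P :|: Q) || (q \in [set x; z]) && (p \in P :|: Q).

Let dis y : y \in [set x; z] -> y \in P :|: Q -> False.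
Proof.
rewrite !inE => /orP[]/eqP -> /orP[/hP|/hQ] []; rewrite ?adj_irr ?eqxx //.
Qed.

(** [x] hands its neighbours in [P] to [z] and receives those of [z] in [Q]. Equal sizes keep the
    degrees of [x] and [z]; any other affected vertex trades one of them for the other. *)
Lemma exchange : exists G' : sgraph V, same_deg G G' /\
  forall p q, G' p q = G p q (+) exchange_rel p q.
Proof.
have sD : symmetric exchange_rel by move=> p q; rewrite /exchange_rel orbC.
have iD : irreflexive exchange_rel.
  move=> p; rewrite /exchange_rel orbb; apply/negP => /andP[]; exact: dis.
exists (toggle sD iD); split=> // y; rewrite deg_toggle //.
have [yxz|yxz] := boolP (y \in [set x; z]).
  have yPQ : y \notin P :|: Q by apply/negP => /(dis yxz).
  have E q : exchange_rel y q = (q \in P :|: Q).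
    by rewrite /exchange_rel yxz (negPf yPQ) andbF orbF.
  move: yxz; rewrite !inE => /orP[]/eqP eqy; subst y.
    transitivity #|P|; last rewrite cardPQ; apply: eq_card => q.
      rewrite !inE E inE; have [/hP[-> _ _] //|_] := boolP (q \in P).
      by have [/hQ[_ /negPf-> _] //|] := boolP (q \in Q).
    rewrite !inE E inE; have [/hQ[_ -> _]|_] := boolP (q \in Q); first by rewrite orbT.
    by have [/hP[-> _ _] //|] := boolP (q \in P).
  transitivity #|Q|; last rewrite -cardPQ; apply: eq_card => q.
    rewrite !inE E inE; have [/hQ[-> _ _]|_] := boolP (q \in Q); first by rewrite orbT.
    by have [/hP[_ /negPf-> _] //|] := boolP (q \in P).
  rewrite !inE E inE; have [/hP[_ -> _] //|_] := boolP (q \in P).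
  by have [/hQ[-> _ _] //|] := boolP (q \in Q).
have [yPQ|yPQ] := boolP (y \in P :|: Q); last first.
  by congr #|pred_of_set _|; apply/setP => q;
    rewrite !inE /exchange_rel (negPf yPQ) (negPf yxz) andbF.
have E q : exchange_rel y q = (q \in [set x; z]).
  by rewrite /exchange_rel yPQ (negPf yxz) andbT.
(* Of the two vertices [x] and [z], [a] is the neighbour of [y] before the exchange and [b] the one
   after it. *)
have [a [b [gya gyb Eab]]] : exists a b, [/\ G y a, ~~ G y b & [set x; z] = [set a; b]].
  move: yPQ; rewrite inE => /orP[/hP[xy zy _]|/hQ[zy xy _]].
    by exists x, z; rewrite ![G y _]adj_sym.
  by exists z, x; rewrite ![G y _]adj_sym setUC.
transitivity 1; [rewrite -(cards1 a) | rewrite -(cards1 b)]; apply: eq_card => q;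
  rewrite !inE E Eab !inE.
  case: (eqVneq q a) => [->//|_]; case: (eqVneq q b) => [->|//]; exact: negPf.
case: (eqVneq q b) => [->|_]; first by rewrite orbT.
by case: (eqVneq q a) => [->|//]; rewrite gya.
Qed.

End Exchange.

(** This is the exchange between [a] and [d] with the singletons of [b] and [c]. The last two
    clauses say that only [a b] and [c d] can be lost and only [a c] and [b d] gained. *)
Lemma switch (V : finType) (G : sgraph V) (a b c d : V) :
  G a b -> G c d -> a != c -> b != d -> ~~ G a c -> ~~ G b d ->
  exists G' : sgraph V, [/\ same_deg G G', G' a c, G' b d,
    forall p q, G p q -> ~~ epair p q a b -> ~~ epair p q c d -> G' p q &
    forall p q, G' p q -> [|| G p q, epair p q a c | epair p q b d]].
Proof.
move=> ab cd ac bd nac nbd.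
have ad : a != d by apply: contraTneq cd => <-; rewrite adj_sym.
have bc : b != c by apply: contraTneq ab => ->.
have ab' : a != b by apply: contraTneq ab => ->; rewrite adj_irr.
have cd' : c != d by apply: contraTneq cd => ->; rewrite adj_irr.
have [|y|y|G' [sd E]] := @exchange V G a d [set b] [set c].
- by rewrite !cards1.
- by move/set1P->; rewrite ab bd adj_sym nbd.
- by move/set1P->; rewrite adj_sym cd eq_sym ac nac.
have rE p q : exchange_rel a d [set b] [set c] p q =
    [|| epair p q a b, epair p q c d, epair p q a c | epair p q b d].
  rewrite /exchange_rel /epair !inE.
  by do ![case: eqP => ? //=]; subst; rewrite ?eqxx in ab' cd' ac bd ad bc *.
exists G'; split=> //.
- rewrite E rE /epair !eqxx (negPf nac) /= ?(negPf cd') !orbT //.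
- by rewrite E rE /epair !eqxx (negPf nbd) /= !orbT.
- move=> p q pq nab ncd; rewrite E rE (negPf nab) (negPf ncd) pq /=.
  apply/negP => /orP[]/orP[]/andP[/eqP ? /eqP ?]; subst; move: pq;
  by rewrite ?(negPf nac) ?(negPf nbd) // adj_sym ?(negPf nac) ?(negPf nbd).
move=> p q; rewrite E rE; case: (boolP (G p q)) => //= npq.
by case/or4P=> [/orP[]/andP[/eqP ? /eqP ?] | /orP[]/andP[/eqP ? /eqP ?] | -> // | ->];
  rewrite ?orbT //; subst; move: npq; rewrite ?ab ?cd // adj_sym ?ab ?cd.
Qed.

(** * The counting argument around a missed vertex *)

Lemma card_closed_nbr (V : finType) (G : sgraph V) (S : {set V}) c :
  (forall z, z \in S -> (z == c) || G z c) -> #|S| <= (deg G c).+1.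
Proof.
move=> cS; rewrite -add1n -(cards1 c) /deg.
apply: leq_trans (leq_card_setU _ _).1; apply: subset_leq_card.
by apply/subsetP => z /cS; rewrite !inE adj_sym.
Qed.

Lemma main_count_arith s aMM aM aT aJ m j q d rho :
  s + aMM = 2 * aM + (aT + 2 * aJ) -> m * (q - 1) <= aMM -> aM <= m * d ->
  aT <= rho.+1 * rho -> aJ <= j * rho.-1 -> m + j + 2 <= 2 * rho -> q < rho ->
  d <= q + rho.-1 -> s + 9 * rho <= 7 * rho ^ 2 + 4.
Proof.
case: rho => // p /=; rewrite !ltnS => sE insM leM leT leJ mj qp dq.
have H1 : 2 * (m * d) <= m * (q - 1) + m * (3 * p + 1).
  rewrite mulnCA -mulnDr leq_mul2l; apply/orP; right; lia.
have H2 : m * (3 * p + 1) + 2 * (j * p) <= 2 * p * (3 * p + 1).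
  apply: leq_trans (_ : (m + j) * (3 * p + 1) <= _); last by rewrite leq_mul2r; lia.
  by rewrite mulnDl leq_add2l mulnCA leq_mul2l; lia.
have -> : p.+1 ^ 2 = p * p + 2 * p + 1 by rewrite -mulnn; lia.
have -> : 7 * (p * p + 2 * p + 1) + 4 = 2 * p * (3 * p + 1) + p.+2 * p.+1 + 9 * p.+1.
  by lia.
lia.
Qed.

(* [A] and [B] are the outer neighbourhoods of [x] and [v], [CA] and [CB] the sets of
   common closed neighbours of [A] and of [B]. By [edge_out] an edge which is not inside
   [T] has both ends in [CA], or both in [CB], or one end in both, so that [M] and [J]
   cover these edges. *)
Section MainCount.
Variables (V : finType) (G : sgraph V) (R A B CA CB M J : {set V}) (v x a0 b0 : V).
Hypotheses (vR : v \notin R) (xR : x \in R) (vx : ~~ G v x).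
Notation T := (v |: R).
Hypotheses (AE : forall a, (a \in A) = G x a && (a \notin R))
  (BE : forall b, (b \in B) = G v b && (b \notin R)).
Hypotheses (a0A : a0 \in A) (b0B : b0 \in B).
Hypothesis adjAB : forall a b, a \in A -> b \in B -> (a == b) || G a b.
Hypothesis edge_out : forall p q a b, G p q -> ~~ ((p \in T) && (q \in T)) ->
  a \in A -> b \in B -> (p == a) || G p a || ((q == b) || G q b).
Hypothesis low_out : forall z, z \notin T -> deg G z <= deg G x.
Hypothesis vmax : forall z, deg G z <= deg G v.
Hypothesis clique_bound : forall C, clique G C -> #|C| <= #|R|.
Hypothesis CAP : forall z,
  reflect (forall a, a \in A -> (z == a) || G z a) (z \in CA).
Hypothesis CBP : forall z,
  reflect (forall b, b \in B -> (z == b) || G z b) (z \in CB).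
Hypothesis ME : forall z, (z \in M) = ((z \in CA) || (z \in CB)) && (z \notin T).
Hypothesis JE : forall z,
  (z \in J) = [&& z \in CA, z \in CB, z \in R & z != x].

Let CAPn z : z \notin CA -> exists2 a, a \in A & ((z == a) || G z a) = false.
Proof.
move=> nz; apply: contrapT => no; move/negP: nz; apply; apply/CAP => a aA.
by case E: (_ || _) => //; case: no; exists a.
Qed.

Let CBPn z : z \notin CB -> exists2 b, b \in B & ((z == b) || G z b) = false.
Proof.
move=> nz; apply: contrapT => no; move/negP: nz; apply; apply/CBP => a aA.
by case E: (_ || _) => //; case: no; exists a.
Qed.

Let A_out a : a \in A -> [/\ G x a, a \notin R, a != v & a \notin T].
Proof.
rewrite AE => /andP[xa aR]; have av : a != v.
  by apply: contraTneq xa => ->; rewrite adj_sym.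
by split=> //; rewrite !inE negb_or av.
Qed.

Let B_out b : b \in B -> [/\ G v b, b \notin R, b != x & b \notin T].
Proof.
rewrite BE => /andP[vb bR]; split=> //.
  by apply: contraTneq vb => ->.
by rewrite !inE negb_or bR andbT; apply: contraTneq vb => ->; rewrite adj_irr.
Qed.

Let A_CB a : a \in A -> a \in CB.
Proof. by move=> aA; apply/CBP => b bB; apply: adjAB. Qed.

Let B_CA b : b \in B -> b \in CA.
Proof. by move=> bB; apply/CAP => a aA; rewrite eq_sym adj_sym; apply: adjAB. Qed.

Let x_CA : x \in CA.
Proof. by apply/CAP => a; rewrite AE => /andP[-> _]; rewrite orbT. Qed.

Let v_CB : v \in CB.
Proof. by apply/CBP => b; rewrite BE => /andP[-> _]; rewrite orbT. Qed.

Let A_M a : a \in A -> a \in M.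
Proof. by move=> aA; rewrite ME A_CB // orbT; case: (A_out aA). Qed.

Let B_M b : b \in B -> b \in M.
Proof. by move=> bB; rewrite ME B_CA //; case: (B_out bB). Qed.

(** If [b'] misses [b], apply [edge_out] to the edges from [A] to [b']: the alternative at [b]
    fails, so the end in [A] is joined to every other [a]. *)
Let cliqueA : (exists2 b, b \in B & b \notin CB) -> clique G A.
Proof.
case=> b' b'B /CBPn[b bB nb'] p a pA aA pa.
have /orP[/eqP eqpb|pb'] := adjAB pA b'B.
  by move: nb'; rewrite -eqpb (adjAB pA bB).
have := @edge_out p b' a b pb' _ aA bB; rewrite nb' (negPf pa) orbF; apply.
by case: (A_out pA) => _ _ _ /negPf->.
Qed.

Let degxA : deg G x <= #|A| + #|R|.-1.
Proof.
rewrite /deg -(cardsID R) addnC leq_add //.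
  by apply: subset_leq_card; apply/subsetP => y; rewrite !inE AE andbC.
have := card_nbr_lt G xR; congr (_ <= _).
by apply: eq_card => y; rewrite !inE andbC.
Qed.

Let degvB : deg G v <= #|B| + #|R|.-1.
Proof.
rewrite /deg -(cardsID R) addnC leq_add //.
  by apply: subset_leq_card; apply/subsetP => y; rewrite !inE BE andbC.
rewrite (cardsD1 x R) xR /=; apply: subset_leq_card.
apply/subsetP => y; rewrite !inE => /andP[vy ->]; rewrite andbT.
by apply: contraTneq vy => ->.
Qed.

Let card_clique1 C y : clique G C -> (forall z, z \in C -> G y z) -> #|C| < #|R|.
Proof.
move=> cl yC; have yn : y \notin C by apply/negP => /yC; rewrite adj_irr.
have := @clique_bound (y |: C); rewrite cardsU1 yn; apply.
move=> p q; rewrite !inE => /predU1P[->|pC] /predU1P[->|qC] pq.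
- by rewrite eqxx in pq.
- exact: yC.
- by rewrite adj_sym; apply: yC.
- exact: cl.
Qed.

(** Either [B] lies in [CB] and is a clique, which [v] extends, or [A] is a clique, which [x]
    extends. *)
Let minAB : minn #|A| #|B| < #|R|.
Proof.
have [[b bB nb]|no] := EM (exists2 b, b \in B & b \notin CB).
  rewrite gtn_min (card_clique1 (y := x)) //; first by apply: cliqueA; exists b.
  by move=> z /A_out[].
rewrite gtn_min [X in _ || X](card_clique1 (y := v)) ?orbT //; last by move=> z /B_out[].
move=> p q pB qB pq; have: p \in CB by apply: contrapT => /negP np; apply: no; exists p.
by move/CBP/(_ _ qB); rewrite (negPf pq).
Qed.

Let MJ_disj : [disjoint M & J].
Proof.
rewrite -setI_eq0 -subset0; apply/subsetP => z; rewrite !inE ME JE !inE.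
by case: (z \in R); rewrite ?orbT ?andbF.
Qed.

Let MJP z : z \in M :|: J -> [/\ z != v, z != x & (z \in CA) || (z \in CB)].
Proof.
rewrite inE ME JE !inE negb_or => /orP[/and3P[-> -> zR]|/and4P[-> -> zR ->]].
  by split=> //; apply: contraNneq zR => ->.
by split=> //; apply: contraTneq zR => ->.
Qed.

(** Together with [x], this set lies in the closed neighbourhood of [a0], an outer vertex and so of
    degree at most that of [x]. *)
Let cardCA : #|(M :|: J) :&: CA| <= deg G x.
Proof.
have [_ _ _ a0T] := A_out a0A.
apply: leq_trans (_ : deg G a0 <= _); last exact: low_out.
have wn : x \notin (M :|: J) :&: CA.
  by apply/negP => /setIP[/MJP[]]; rewrite eqxx.
have := @card_closed_nbr _ G (x |: (M :|: J) :&: CA) a0; rewrite cardsU1 wn; apply.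
move=> z zz; have : z \in CA by move: zz => /setU1P[->|/setIP[]].
by move/CAP; apply.
Qed.

Let cardCB : #|(M :|: J) :&: CB| <= deg G x.
Proof.
have [_ _ _ b0T] := B_out b0B.
apply: leq_trans (_ : deg G b0 <= _); last exact: low_out.
have wn : v \notin (M :|: J) :&: CB.
  by apply/negP => /setIP[/MJP[]]; rewrite eqxx.
have := @card_closed_nbr _ G (v |: (M :|: J) :&: CB) b0; rewrite cardsU1 wn; apply.
move=> z zz; have : z \in CB by move: zz => /setU1P[->|/setIP[]].
by move/CBP; apply.
Qed.

(** In the first three cases [M :|: J] fits into one closed neighbourhood of an outer vertex, whose
    degree is at most deg x <= min(|A|,|B|) + |R| - 1. Otherwise two neighbourhoods are needed, but
    these overlap in [A :|: B]. *)
Let cardMJ : #|M| + #|J| + 2 <= 2 * #|R|.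
Proof.
have Rge := minAB.
have degx : deg G x <= minn #|A| #|B| + #|R|.-1.
  by rewrite addn_minl leq_min degxA (leq_trans (vmax x)).
have -> : #|M| + #|J| = #|M :|: J|.
  by rewrite cardsU; move: MJ_disj; rewrite -setI_eq0 => /eqP->; rewrite cards0 subn0.
have [[c [cA cB]]|AB0] := EM (exists c, c \in A /\ c \in B).
  have [_ _ _ cT] := A_out cA.
  have : #|[set x; v] :|: (M :|: J)| <= (deg G c).+1.
    apply: card_closed_nbr => z.
    case/setUP=> [/set2P[]->|/MJP[_ _ /orP[/CAP/(_ _ cA)|/CBP/(_ _ cB)]//]].
      by case: (A_out cA) => ->; rewrite orbT.
    by case: (B_out cB) => ->; rewrite orbT.
  rewrite cardsU cards2.
  rewrite [_ :&: _](_ : _ = set0); last first.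
    apply/eqP; rewrite -subset0; apply/subsetP => z /setIP[/set2P[]-> /MJP[]].
      by rewrite eqxx.
    by rewrite eqxx.
  have xv : x != v by apply: contraNneq vR => <-.
  rewrite cards0 xv; move: (low_out cT) Rge degx; clear; lia.
have [CBonly|nCB] := boolP (M :|: J \subset CB).
  by move: cardCB; rewrite (setIidPl CBonly); move: Rge degx; clear; lia.
have [CAonly|nCA] := boolP (M :|: J \subset CA).
  by move: cardCA; rewrite (setIidPl CAonly); move: Rge degx; clear; lia.
(* As [J] lies in both [CA] and [CB], [p] and [q] belong to [M], hence are outside [T]. Edges at [p]
   and [q] then put [A] into [CA] and [B] into [CB] through [edge_out]. *)
have [p pMJ npA] := subsetPn nCA; have [q qMJ nqB] := subsetPn nCB.
have [pv px pC] := MJP pMJ; have [qv qx qC] := MJP qMJ.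
have pCB : p \in CB by move: pC; rewrite (negPf npA).
have qCA : q \in CA by move: qC; rewrite (negPf nqB) orbF.
have pT : p \notin T by move: pMJ; rewrite inE ME JE (negPf npA) orbF; case/andP.
have qT : q \notin T by move: qMJ; rewrite inE ME JE (negPf nqB) andbF orbF; case/andP.
have A_CA a : a \in A -> a \in CA.
  move=> aA; apply/CAP => a' a'A; have [b bB nqb] := CBPn nqB.
  have /CAP/(_ _ aA)/orP[/eqP eqa|qa] := qCA.
    by move: nqB; rewrite eqa A_CB.
  have := @edge_out a q a' b; rewrite nqb orbF; apply => //.
    by rewrite adj_sym.
  by rewrite (negPf qT) andbF.
have B_CB b : b \in B -> b \in CB.
  move=> bB; apply/CBP => b' b'B; have [a aA npa] := CAPn npA.
  have /CBP/(_ _ bB)/orP[/eqP eqb|pb] := pCB.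
    by move: npA; rewrite eqb B_CA.
  by have := @edge_out p b a b'; rewrite npa; apply; rewrite ?(negPf pT).
have subI : A :|: B \subset (M :|: J) :&: CA :&: ((M :|: J) :&: CB).
  apply/subsetP => z; rewrite !(inE, in_setI) => /orP[zA|zB].
    by rewrite (A_M zA) A_CA ?A_CB.
  by rewrite (B_M zB) B_CA ?B_CB.
have eqU : M :|: J = (M :|: J) :&: CA :|: (M :|: J) :&: CB.
  rewrite -setIUr; apply/esym/setIidPl/subsetP => z /MJP[_ _].
  by rewrite inE.
have eqAB : #|A :|: B| = #|A| + #|B|.
  rewrite cardsU [A :&: B](_ : _ = set0) ?cards0 ?subn0 //.
  by apply/eqP; rewrite -subset0; apply/subsetP => z /setIP[zA zB]; case: AB0; exists z.
have := subset_leq_card subI; rewrite eqAB.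
have := cardsUI ((M :|: J) :&: CA) ((M :|: J) :&: CB); rewrite -eqU.
by move: cardCA cardCB degxA (leq_trans (vmax x) degvB) Rge; clear; lia.
Qed.

Let MJ_inside y : y \in M -> minn #|A| #|B| - 1 <= #|[set z in M | G y z]|.
Proof.
have le (S : {set V}) : S \subset M -> (forall z, z \in S -> (y == z) || G y z) ->
    #|S| - 1 <= #|[set z in M | G y z]|.
  move=> SM yS; rewrite leq_subLR -[X in X <= _](cardsID [set y] S); apply: leq_add.
    by rewrite -(cards1 y) subset_leq_card // subsetIr.
  apply: subset_leq_card; apply/subsetP => z; rewrite !inE => /andP[zy zS].
  by rewrite (subsetP SM) //=; have := yS z zS; rewrite eq_sym (negPf zy).
rewrite ME => /andP[/orP[/CAP|/CBP] yS _].
  by apply: leq_trans (le A _ yS); [rewrite leq_sub2r // geq_minl | apply/subsetP].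
by apply: leq_trans (le B _ yS); [rewrite leq_sub2r // geq_minr | apply/subsetP].
Qed.

(** Such a [y] already sees all of [B], which lies in [M], and its degree is at most deg v <= |B| +
    |R| - 1. *)
Let J_outside y : y \in J -> #|[set z in ~: (T :|: M) | G y z]| <= #|R|.-1.
Proof.
rewrite JE => /and4P[yA yB yR _]; rewrite -(leq_add2l #|B|).
apply: leq_trans degvB; apply: leq_trans (vmax y).
rewrite /deg -[leqRHS](cardsID M); apply: leq_add.
  apply: subset_leq_card; apply/subsetP => b bB; rewrite !inE B_M // andbT.
  have /CBP/(_ _ bB)/orP[/eqP eqb|//] := yB.
  by move: yR; rewrite eqb; case: (B_out bB) => _ /negPf->.
by apply: subset_leq_card; apply/subsetP => z; rewrite !inE negb_or => /andP[/andP[_ ->] ->].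
Qed.

(** [p] misses some [a] and some [b], so [edge_out] forces [q] into both [CA] and [CB]. If [q] were
    [x] or [v], then [p] would be in [A] or [B], hence in [M]. *)
Let out_edge p q : p \notin T :|: M -> G p q -> q \in M :|: J.
Proof.
rewrite inE negb_or ME => /andP[pT]; rewrite pT andbT negb_or => /andP[pA pB] pq.
have [a aA na] := CAPn pA; have [b bB nb] := CBPn pB.
have qA : q \in CA.
  apply/CAP => a' a'A; have := @edge_out q p a' b; rewrite nb orbF; apply=> //.
    by rewrite adj_sym.
  by rewrite (negPf pT) andbF.
have qB : q \in CB.
  by apply/CBP => b' b'B; have := @edge_out p q a b'; rewrite na; apply; rewrite // (negPf pT).
rewrite inE ME JE qA qB /= !inE negb_or.
move: pT; rewrite !inE negb_or => /andP[pv pR].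
have [eqx|_] := eqVneq q x.
  by move: pB; rewrite A_CB // AE adj_sym -eqx pq.
have [eqv|_] := eqVneq q v; last by rewrite andbT /= orNb.
by move: pA; rewrite B_CA // BE adj_sym -eqv pq.
Qed.

Lemma main_count_aux : \sum_z deg G z + 9 * #|R| <= 7 * #|R| ^ 2 + 4.
Proof.
set U := ~: (T :|: M).
have TM : [disjoint T & M].
  rewrite -setI_eq0 -subset0; apply/subsetP => z /setIP[zT].
  by rewrite ME zT andbF.
have UT : (~: M) :\: T = U.
  by apply/setP => z; rewrite !inE -negb_or.
have nMT : ~: M :&: T = T.
  apply/setIidPr; rewrite -disjoints_subset //.
have sumM : arcs G M setT <= #|M| * deg G x.
  rewrite -sum_deg_in -sum_nat_const; apply: leq_sum => z.
  by rewrite ME => /andP[_]; apply: low_out.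
have insM : #|M| * (minn #|A| #|B| - 1) <= arcs G M M by apply: arcs_ge.
have insT : arcs G T T <= #|R|.+1 * #|R|.
  by have := arcs_inside G T; rewrite cardsU1 vR.
have JU : arcs G J U <= #|J| * #|R|.-1 by apply: arcs_le.
have zero (C D : {set V}) : (forall p q, p \in C -> q \in D -> G p q -> False) -> arcs G C D = 0.
  move=> no; apply: big1 => p pC; apply: big1 => q qD.
  by case: (boolP (G p q)) => // /(no p q pC qD).
have UU : arcs G U U = 0.
  apply: zero => p q; rewrite !inE => pU qU pq.
  have := out_edge _ pq; rewrite !inE => /(_ pU); rewrite JE.
  case/orP=> [qM|/and4P[_ _ qR _]]; first by rewrite qM orbT in qU.
  by rewrite qR !orbT in qU.
have TU : arcs G T U = arcs G J U.
  have JT : T :&: J = J.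
    by apply/setIidPr/subsetP => z; rewrite JE !inE => /and4P[_ _ -> _]; rewrite orbT.
  rewrite (arcs_splitl G J) JT (zero (T :\: J)) ?addn0 // => p q.
  rewrite in_setD => /andP[pJ pT]; rewrite inE => qU; rewrite adj_sym => qp.
  have := out_edge qU qp; rewrite inE (negPf pJ) orbF => pM.
  by move/pred0P/(_ p): TM => /=; rewrite pT pM.
(* [T], [M] and [U] partition the vertices. Doubling the arcs from [M] counts those inside [M] once
   too often, whence the term [arcs G M M] on the left. *)
have sumE : \sum_z deg G z + arcs G M M = 2 * arcs G M setT + (arcs G T T + 2 * arcs G J U).
  have e1 := arcs_splitl G M setT setT; have e2 := arcs_splitr G M M setT.
  have e3 := arcs_splitr G M (~: M) setT; have e4 := arcs_splitl G T (~: M) (~: M).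
  have e5 := arcs_splitr G T T (~: M); have e6 := arcs_splitr G T U (~: M).
  rewrite setTI setTD in e1 e2 e3; rewrite UT nMT in e4 e5 e6.
  rewrite UU (arcsC G U T) in e6; rewrite (arcsC G (~: M) M) in e3.
  rewrite sum_deg -TU; move: e1 e2 e3 e4 e5 e6; clear; lia.
apply: (main_count_arith sumE insM sumM insT JU cardMJ minAB).
by rewrite addn_minl leq_min degxA (leq_trans (vmax x)).
Qed.

End MainCount.

Lemma main_count (V : finType) (G : sgraph V) (R : {set V}) (v x a0 b0 : V) :
  v \notin R -> x \in R -> ~~ G v x ->
  G x a0 -> a0 \notin R -> G v b0 -> b0 \notin R ->
  (forall a b, G x a -> a \notin R -> G v b -> b \notin R -> (a == b) || G a b) ->
  (forall p q a b, G p q -> ~~ ((p \in v |: R) && (q \in v |: R)) ->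
    G x a -> a \notin R -> G v b -> b \notin R ->
    (p == a) || G p a || ((q == b) || G q b)) ->
  (forall z, z \notin v |: R -> deg G z <= deg G x) ->
  (forall z, deg G z <= deg G v) ->
  (forall C, clique G C -> #|C| <= #|R|) ->
  \sum_z deg G z + 9 * #|R| <= 7 * #|R| ^ 2 + 4.
Proof.
move=> vR xR vx xa0 a0R vb0 b0R adjAB edge_out low_out vmax cl.
pose A := [set a | G x a & a \notin R]; pose B := [set b | G v b & b \notin R].
pose cn (S : {set V}) := [set z | [forall s in S, (z == s) || G z s]].
have cnP (S : {set V}) z : reflect (forall s, s \in S -> (z == s) || G z s) (z \in cn S).
  by rewrite inE; apply: forall_inP.
apply: (@main_count_aux V G R A B (cn A) (cn B) ((cn A :|: cn B) :\: (v |: R))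
  (cn A :&: cn B :&: (R :\ x)) v x a0 b0) => //.
- by move=> a; rewrite inE.
- by move=> b; rewrite inE.
- by rewrite inE xa0 a0R.
- by rewrite inE vb0 b0R.
- by move=> a b; rewrite !inE => /andP[xa aR] /andP[vb bR]; apply: adjAB.
- by move=> p q a b pq pqT; rewrite !inE => /andP[xa aR] /andP[vb bR]; apply: edge_out.
- by move=> z; rewrite in_setD andbC in_setU.
- by move=> z; rewrite !in_setI in_setD1 -andbA [_ && (z \in R)]andbC.
Qed.

(** * Optimal placements *)

Lemma exists_max (P : nat -> Prop) m n0 : P n0 -> (forall n, P n -> n <= m) ->
  exists2 n, P n & forall n', P n' -> n' <= n.
Proof.
move=> P0 le; have ex : exists n, `[< P n >] by exists n0; apply/asboolP.
have le' n : `[< P n >] -> n <= m by move/asboolP/le.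
case: (ex_maxnP ex le') => n /asboolP Pn max; exists n => // n' Pn'.
by apply: max; apply/asboolP.
Qed.

Section Placement.
Variables (V W : finType) (v : V) (F : sgraph W) (w : W -> nat).
Implicit Types (G : sgraph V) (phi : W -> V).

Definition placed G phi :=
  [/\ injective phi, forall u, phi u != v & forall u u', F u u' -> G (phi u) (phi u')].

Definition hits G phi := \sum_u G v (phi u).
Definition weight G phi := \sum_u w u * deg G (phi u).

Definition hit_max G phi := placed G phi /\
  forall G' phi', same_deg G G' -> placed G' phi' -> hits G' phi' <= hits G phi.

(** A lexicographic maximum: given [hit_max], the inequality between hits can only be an
    equality. *)
Definition optimal G phi := hit_max G phi /\
  forall G' phi', same_deg G G' -> placed G' phi' -> hits G phi <= hits G' phi' ->
  weight G' phi' <= weight G phi.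

Lemma hits_le G phi : hits G phi <= #|W|.
Proof. by rewrite -sum1_card; apply: leq_sum => u _; case: (G v _). Qed.

Lemma weight_le G phi : weight G phi <= (\sum_u w u) * #|V|.
Proof.
rewrite big_distrl; apply: leq_sum => u _; rewrite leq_mul2l.
by rewrite (leq_trans (deg_lt G _) (leq_pred _)) orbT.
Qed.

Lemma same_deg_trans G G' G'' : same_deg G G' -> same_deg G' G'' -> same_deg G G''.
Proof. by move=> e e' x; rewrite e. Qed.

Lemma exists_optimal G phi : placed G phi ->
  exists G' phi', same_deg G G' /\ optimal G' phi'.
Proof.
move=> pl.
pose P n := exists G' phi', [/\ same_deg G G', placed G' phi' & hits G' phi' = n].
have [|n [G' [phi' [_ _ <-]]]|n [G1 [phi1 [sd1 pl1 <-]]] max1] :=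
  @exists_max P #|W| (hits G phi).
- by exists G, phi.
- exact: hits_le.
pose Q n := exists G' phi', [/\ same_deg G G', placed G' phi',
  hits G1 phi1 <= hits G' phi' & weight G' phi' = n].
have [|n' [G' [phi' [_ _ _ <-]]]|n' [G2 [phi2 [sd2 pl2 h2 <-]]] max2] :=
  @exists_max Q ((\sum_u w u) * #|V|) (weight G1 phi1).
- by exists G1, phi1.
- exact: weight_le.
exists G2, phi2; split=> //; split; last first.
  move=> G' phi' sd' pl' h'; apply: max2; exists G', phi'; split=> //.
    exact: same_deg_trans sd2 sd'.
  exact: leq_trans h2 h'.
split=> // G' phi' sd' pl'; apply: leq_trans h2; apply: max1.
by exists G', phi'; split=> //; apply: same_deg_trans sd2 sd'.
Qed.

Section HitMax.
Variables (G : sgraph V) (phi : W -> V).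
Hypothesis hm : hit_max G phi.
Notation R := [set phi u | u : W].

Let inj_phi : injective phi. Proof. by case: hm => [[]]. Qed.
Let phi_v u : phi u != v. Proof. by case: hm => [[]]. Qed.
Let phi_edge u u' : F u u' -> G (phi u) (phi u').
Proof. by case: hm => [[_ _]] + _; apply. Qed.

Lemma phi_in u : phi u \in R.
Proof. exact: imset_f. Qed.

Lemma notin_phi z u : z \notin R -> phi u != z.
Proof. by move=> zR; apply: contraNneq zR => <-; apply: phi_in. Qed.

(** Allows a preparatory switch that leaves the hits alone, so that [hit_switch] can be used again
    in the new realization. *)
Lemma hit_max_step G' : same_deg G G' ->
  (forall u u', F u u' -> G' (phi u) (phi u')) ->
  (forall u, G v (phi u) -> G' v (phi u)) -> hit_max G' phi.
Proof.
move=> sd ed hv; split=> // G'' phi'' sd'' pl''.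
apply: leq_trans (_ : hits G phi <= _).
  by case: hm => _; apply=> //; apply: same_deg_trans sd sd''.
by apply: leq_sum => u _; case: (boolP (G v (phi u))) => // /hv ->.
Qed.

(** Otherwise trading the edges from [phi u] to [y] and from [v] to [b] for [phi u]-[v] and [y]-[b]
    would gain a hit. The last hypothesis says that the first of them carries no edge of the placed
    [F], and [b] lies outside [R], so nothing is lost. *)
Lemma hit_switch u y b : ~~ G v (phi u) -> G (phi u) y -> G v b -> b \notin R ->
  (forall u', phi u' = y -> ~~ F u u') -> (y == b) || G y b.
Proof.
move=> nvu uy vb bR prot; apply: contrapT => /negP; rewrite negb_or => /andP[yb nyb].
have [||||||G' [sd vu yb' keep _]] := @switch V G (phi u) y v b => //.
  by rewrite adj_sym.
have yv : y != v by apply: contraTneq uy => ->; rewrite adj_sym.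
have hv u' : G v (phi u') -> G' v (phi u').
  move=> vu'; apply: keep => //; rewrite /epair ?eqxx.
    by rewrite !(eq_sym v) (negPf (phi_v _)) (negPf yv).
  rewrite (negPf (notin_phi _ bR)) negb_or /=.
  by apply: contraTN vb => /andP[/eqP <-]; rewrite adj_irr.
have pl : placed G' phi.
  split=> // u1 u2 F12; apply: keep; first exact: phi_edge.
    rewrite /epair negb_or; apply/andP; split.
      apply/negP => /andP[/eqP/inj_phi e1 /eqP/prot]; by rewrite -e1 F12.
    by apply/negP => /andP[/eqP/prot + /eqP/inj_phi e1]; rewrite -e1 adj_sym F12.
  by rewrite /epair (negPf (phi_v u1)) (negPf (phi_v u2)) andbF.
case: hm => _ /(_ _ _ sd pl); rewrite leqNgt => /negP; apply.
rewrite /hits (bigD1 u) //= (negPf nvu) [X in _ < X](bigD1 u) //=.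
rewrite adj_sym vu ltnS; apply: leq_sum => u' _.
by case: (boolP (G v (phi u'))) => // /hv ->.
Qed.

End HitMax.

(* A hexagonal switch at [x a, p q, b v], done as two ordinary switches. *)
Lemma hit_edge G phi u p q a b (R := [set phi u | u : W]) : hit_max G phi ->
  ~~ G v (phi u) -> G p q -> ~~ ((p \in v |: R) && (q \in v |: R)) ->
  G (phi u) a -> a \notin R -> G v b -> b \notin R ->
  (p == a) || G p a || ((q == b) || G q b).
Proof.
set x := phi u => hm nvx pq pqT xa aR vb bR.
have [inj phi_v phi_edge] := proj1 hm; have inR z u' := @notin_phi phi z u'.
apply: contrapT => /negP; rewrite !negb_or => /andP[/andP[pa npa] /andP[qb nqb]].
have av : a != v by apply: contraTneq xa => ->; rewrite adj_sym.
have bv : b != v by apply: contraTneq vb => ->; rewrite adj_irr.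
have xv : x != v by apply: phi_v.
have xa' : x != a by apply: inR.
have xb : x != b by apply: inR.
have pq' : p != q by apply: contraTneq pq => ->; rewrite adj_irr.
have unprot z : z \notin R -> forall u', phi u' = z -> ~~ F u u'.
  by move=> zR u' eqz; have := inR _ u' zR; rewrite eqz eqxx.
have sw y z : G x y -> G v z -> z \notin R -> (forall u', phi u' = y -> ~~ F u u') ->
    (y == z) || G y z by apply: (hit_switch hm).
have [pT|pT] := boolP (p \in v |: R); last first.
  move: pT; rewrite in_setU1 negb_or => /andP[pv pR].
  have xp : x != p by apply: inR.
  have nvp : ~~ G v p.
    apply/negP => vp; have := sw a p xa vp pR (unprot a aR).
    by rewrite eq_sym adj_sym (negPf pa) (negPf npa).
  (* The outer neighbour [b] of [v] is replaced by [p], which is not joined to [a]; this contradicts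
     [hit_switch] in [G']. *)
  have [||||||G' [sd vp' bq' keep back]] := @switch V G v b p q => //.
  - by rewrite eq_sym.
  - by rewrite eq_sym.
  - by rewrite adj_sym.
  have hm' : hit_max G' phi.
    apply: (hit_max_step hm) => // [u1 u2 F12|u1 vu1]; apply: keep.
    - exact: phi_edge.
    - by rewrite /epair !(negPf (phi_v _)) andbF.
    - by rewrite /epair !(negPf (inR _ _ pR)) andbF.
    - exact: vu1.
    - by rewrite /epair (negPf (inR _ _ bR)) andbF (eq_sym v) (negPf bv).
    - by rewrite /epair (eq_sym v) (negPf pv) (negPf (inR _ _ pR)) andbF.
  have nvx' : ~~ G' v x.
    apply/negP => /back; rewrite (negPf nvx) /epair (negPf xp) (negPf xb).
    by rewrite !(eq_sym v) (negPf pv) (negPf bv) !andbF.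
  have xa2 : G' x a.
    apply: keep => //; rewrite /epair.
      by rewrite (negPf xv) (negPf xb).
    by rewrite (negPf xp) (eq_sym a p) (negPf pa) andbF.
  have /orP[|/back] : (a == p) || G' a p.
  - apply: (hit_switch hm' nvx' xa2) => // u' eqa.
    by move: aR; rewrite -eqa phi_in.
  - by rewrite eq_sym (negPf pa).
  rewrite adj_sym (negPf npa) /epair (negPf av) (eq_sym a p) (negPf pa) /=.
  case/orP=> /andP[/eqP e1 /eqP e2]; first by rewrite e2 eqxx in pq'.
  by rewrite e2 vb in nvp.
have qT : q \notin v |: R by rewrite pT in pqT.
move: qT; rewrite in_setU1 negb_or => /andP[qv qR].
have xq : x != q by apply: inR.
have nxq : ~~ G x q.
  apply/negP => xq1; have := sw q b xq1 vb bR (unprot q qR).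
  by rewrite (negPf qb) (negPf nqb).
(* Now [p] may be [v] or a placed vertex, so the change is made at [x]: its outer neighbour [a] is
   replaced by [q], which is not joined to [b]. *)
have [||||||G' [sd ap' xq' keep back]] := @switch V G a x p q => //.
- by rewrite adj_sym.
- by rewrite eq_sym.
- by rewrite adj_sym.
have hm' : hit_max G' phi.
  apply: (hit_max_step hm) => // [u1 u2 F12|u1 vu1]; apply: keep.
  - exact: phi_edge.
  - by rewrite /epair !(negPf (inR _ _ aR)) andbF.
  - by rewrite /epair !(negPf (inR _ _ qR)) andbF.
  - exact: vu1.
  - by rewrite /epair (eq_sym v) (negPf av) (negPf (inR _ _ aR)) andbF.
  - by rewrite /epair !(negPf (inR _ _ qR)) (eq_sym v q) (negPf qv) andbF.
have nvx' : ~~ G' v x.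
  apply/negP => /back; rewrite (negPf nvx) /epair !(eq_sym v) (negPf av) (negPf xv).
  by rewrite (negPf qv) (negPf xa') andbF.
have vb2 : G' v b.
  apply: keep => //; rewrite /epair !(eq_sym v).
    by rewrite (negPf av) (negPf xv).
  by rewrite (negPf qv) (eq_sym b q) (negPf qb) andbF.
have /orP[|/back] : (q == b) || G' q b.
- apply: (hit_switch hm' nvx' xq') => // u' eqq.
  by move: qR; rewrite -eqq phi_in.
- by rewrite (negPf qb).
rewrite (negPf nqb) /epair (eq_sym q x) (negPf xq) (eq_sym b x) (negPf xb) andbF.
rewrite (eq_sym q p) (negPf pq') !orbF => /andP[/eqP e1 /eqP e2].
by rewrite -e1 pq in npa.
Qed.

(** [z] receives every neighbour of [x] other than [v] and [z], and repays [x] with private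
    neighbours of its own; the degree hypothesis, which discounts [v], says that it has enough. If
    [z] plays a role [u1], then [x] takes over that role: by the last hypothesis the vertices it
    must see are common neighbours of [x] and [z], which the exchange leaves alone. *)
Lemma takeover G phi u0 z (x := phi u0) : placed G phi -> x != z -> z != v ->
  deg G x + G v z <= deg G z + G v x ->
  (forall u1, phi u1 = z -> forall u, F u1 u -> u != u0 -> F u0 u) ->
  exists G', [/\ same_deg G G', forall y, G' v y = G v y &
    placed G' (fun u => tperm x z (phi u))].
Proof.
case=> inj phi_v phi_edge xz zv le role.
have xv : x != v by apply: phi_v.
pose P := [set y | [&& G x y, ~~ G z y, y != z & y != v]].
pose Q := [set y | [&& G z y, ~~ G x y, y != x & y != v]].
(* The degree of [p] splits into private neighbours, common neighbours, [q] and [v]. The common part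
   and the edge [x z] cancel in the comparison. *)
have cnt p q : p != q -> q != v -> deg G p = #|[set y | [&& G p y, ~~ G q y, y != q & y != v]]|
    + #|[set y | [&& G p y, G q y & y != v]]| + G p q + G v p.
  move=> pq qv; have := cardsD1 v [set y | G p y].
  have := cardsD1 q ([set y | G p y] :\ v).
  have := cardsID [set y | G q y] ([set y | G p y] :\ v :\ q).
  rewrite !inE qv /= [G p v]adj_sym.
  set X := _ :&: _; set Y := _ :\: [set y | G q y].
  rewrite -/(deg G p) => <- -> ->.
  have -> : #|X| = #|[set y | [&& G p y, G q y & y != v]]|.
    apply: eq_card => y; rewrite !inE.
    case: (eqVneq y q) => [->|_]; first by rewrite adj_irr !andbF.
    by case: (y != v); case: (G p y); case: (G q y).
  have -> : #|Y| = #|[set y | [&& G p y, ~~ G q y, y != q & y != v]]|.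
    apply: eq_card => y; rewrite !inE.
    by case: (y != q); case: (y != v); case: (G p y); case: (G q y).
  by clear; lia.
have PQ : #|P| <= #|Q|.
  have common : #|[set y | [&& G x y, G z y & y != v]]| = #|[set y | [&& G z y, G x y & y != v]]|.
    by apply: eq_card => y; rewrite !inE andbCA.
  have zx : z != x by rewrite eq_sym.
  move: le; rewrite (cnt x z xz zv) (cnt z x zx xv) -/P -/Q common [G z x]adj_sym.
  by clear; lia.
have [Q' Q'Q cQ'] : exists2 Q' : {set V}, Q' \subset Q & #|Q'| = #|P|.
  by have /set0Pn[Q'] : [set Q' : {set V} | Q' \subset Q & #|Q'| == #|P|] != set0;
    [rewrite -card_gt0 cards_draws bin_gt0 | rewrite inE => /andP[? /eqP ?]; exists Q'].
have [|y|y|G' [sd E]] := @exchange V G x z P Q'.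
- by rewrite cQ'.
- by rewrite inE => /and4P[].
- by move/(subsetP Q'Q); rewrite inE => /and4P[].
have Pn y : y \in P -> [/\ y != x, y != z, y != v, G x y & ~~ G z y].
  rewrite inE => /and4P[xy zy -> ->]; split=> //.
  by apply: contraTneq xy => ->; rewrite adj_irr.
have Qn y : y \in Q' -> [/\ y != x, y != z, y != v, ~~ G x y & G z y].
  move/(subsetP Q'Q); rewrite inE => /and4P[zy xy -> ->]; split=> //.
  by apply: contraTneq zy => ->; rewrite adj_irr.
have PQn p : (p \in P :|: Q') -> [/\ p != x, p != z & p != v].
  by rewrite inE => /orP[/Pn[]|/Qn[]].
have notPQ p : [|| p == x, p == z | p == v] -> (p \in P :|: Q') = false.
  by move=> e; apply/negP => /PQn[a b c]; rewrite (negPf a) (negPf b) (negPf c) in e.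
have Gx' y : G x y -> G z y -> G' x y.
  move=> xy zy; have yPQ : (y \in P :|: Q') = false.
    by apply/negP; rewrite inE => /orP[/Pn[_ _ _ _]|/Qn[_ _ _]]; rewrite ?xy ?zy.
  by rewrite E xy /exchange_rel yPQ (notPQ x) ?eqxx // !andbF.
have Gz' y : G x y -> y != v -> y != z -> G' z y.
  move=> xy yv yz; rewrite E /exchange_rel (notPQ z) ?eqxx ?orbT // andbF orbF.
  rewrite !inE eqxx orbT xy yz yv /= andbT.
  have -> : (y \in Q') = false by apply/negP => /Qn[_ _ _]; rewrite xy.
  by rewrite orbF; case: (G z y).
have Gxz : G' x z = G x z.
  by rewrite E /exchange_rel !notPQ ?eqxx ?orbT // !andbF addbF.
have Go p q : p != x -> p != z -> q != x -> q != z -> G' p q = G p q.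
  move=> px pz qx qz; rewrite E /exchange_rel !inE.
  by rewrite (negPf px) (negPf pz) (negPf qx) (negPf qz) addbF.
exists G'; split.
- by move=> y; rewrite sd.
- move=> y; rewrite E /exchange_rel (notPQ v) ?eqxx ?orbT // andbF orbF.
  by rewrite !inE ![v == _]eq_sym (negPf xv) (negPf zv) addbF.
split.
- by move=> u1 u2 /perm_inj/inj.
- by move=> u; case: tpermP => // _; rewrite eq_sym.
have half u1 u2 : F u1 u2 -> phi u2 != x -> phi u2 != z -> G' (tperm x z (phi u1)) (phi u2).
  move=> F12 n2x n2z; have n2 : u2 != u0 by apply: contraNneq n2x => ->.
  case: tpermP => [e1|e1|/eqP n1x /eqP n1z].
  - by apply: Gz' => //; rewrite -e1; apply: phi_edge.
  - apply: Gx'; last by rewrite -e1; apply: phi_edge.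
    by apply: phi_edge; apply: (role u1).
  - by rewrite Go //; apply: phi_edge.
move=> u1 u2 F12; have ed := phi_edge _ _ F12.
case: (tpermP _ _ (phi u2)) => [e2|e2|/eqP n2x /eqP n2z]; last exact: half.
  case: tpermP => [e1|e1|/eqP n1x /eqP n1z].
  - by move: ed; rewrite e1 e2 adj_irr.
  - by rewrite Gxz adj_sym -e1 -e2.
  - rewrite adj_sym; have := @half u2 u1; rewrite e2 tpermL; apply=> //.
    by rewrite adj_sym.
case: tpermP => [e1|e1|/eqP n1x /eqP n1z].
- by rewrite adj_sym Gxz -e1 -e2.
- by move: ed; rewrite e1 e2 adj_irr.
- rewrite adj_sym; have := @half u2 u1; rewrite e2 tpermR; apply=> //.
  by rewrite adj_sym.
Qed.

(** * Degrees around a role that [v] misses *)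

Section Optimal.
Variables (G : sgraph V) (phi : W -> V) (u0 : W).
Hypotheses (opt : optimal G phi) (miss : ~~ G v (phi u0)).
Hypothesis w_gt0 : forall u, 0 < w u.
Notation R := [set phi u | u : W].

(** Otherwise [z] takes over the role [u0]: no hit is lost, since [v] missed that role, and the
    weight grows. *)
Lemma low_outside z : z \notin v |: R -> deg G z <= deg G (phi u0).
Proof.
rewrite in_setU1 negb_or => /andP[zv zR]; rewrite leqNgt; apply/negP => lt.
have phi_z u : phi u != z by apply: notin_phi zR.
have [hm best] := opt; have pl := proj1 hm.
have [|u1 e1|G' [sd sv pl']] := takeover pl (phi_z u0) zv.
- by rewrite (negPf miss); case: (G v z); lia.
- by have := phi_z u1; rewrite e1 eqxx.
have [inj _ _] := pl.
have E u : u != u0 -> tperm (phi u0) z (phi u) = phi u.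
  by move=> ne; rewrite tpermD // eq_sym ?phi_z // (inj_eq inj).
have hle : hits G phi <= hits G' (fun u => tperm (phi u0) z (phi u)).
  apply: leq_sum => u _; have [->|/E ->] := eqVneq u u0; first by rewrite (negPf miss).
  by rewrite sv.
have := best _ _ sd pl' hle; rewrite leqNgt => /negP; apply.
rewrite /weight (bigD1 u0) //= [X in _ < X](bigD1 u0) //= tpermL -sd.
rewrite [X in _ < _ + X](eq_bigr (fun u => w u * deg G (phi u))).
  by rewrite ltn_add2r ltn_pmul2l.
by move=> u /E ->; rewrite sd.
Qed.

(** Otherwise swapping the two roles keeps the placed set, hence the hits, and gives the heavier
    role the larger degree. *)
Lemma low_inside u1 : w u1 < w u0 -> (forall u, F u1 u -> u != u0 -> F u0 u) ->
  deg G (phi u1) <= deg G (phi u0).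
Proof.
move=> w10 role; rewrite leqNgt; apply/negP => lt.
have u10 : u1 != u0 by apply: contraTneq w10 => ->; rewrite ltnn.
have [hm best] := opt; have pl := proj1 hm; have [inj phi_v _] := pl.
have n10 : phi u0 != phi u1 by rewrite (inj_eq inj) eq_sym.
have [|u e1|G' [sd sv pl']] := takeover pl n10 (phi_v u1).
- by rewrite (negPf miss); case: (G v _); lia.
- by rewrite (inj _ _ e1).
have E u : tperm (phi u0) (phi u1) (phi u) = phi (tperm u0 u1 u).
  by rewrite (inj_tperm _ _ _ inj).
have hE : hits G' (fun u => tperm (phi u0) (phi u1) (phi u)) = hits G phi.
  rewrite /hits [RHS](reindex_inj (@perm_inj _ (tperm u0 u1))).
  by apply: eq_bigr => u _; rewrite E sv.
have := best _ _ sd pl'; rewrite hE leqnn leqNgt => /(_ isT)/negP; apply.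
have split (f : W -> nat) : \sum_u f u = f u0 + f u1 + \sum_(u | (u != u0) && (u != u1)) f u.
  by rewrite (bigD1 u0) //= (bigD1 u1) //= addnA.
rewrite /weight !split !E tpermL tpermR -!sd.
rewrite [X in _ < _ + X](eq_bigr (fun u => w u * deg G (phi u))); last first.
  by move=> u /andP[n0 n1]; rewrite E tpermD 1?eq_sym // sd.
rewrite ltn_add2r; move: w10 lt.
move: (deg G (phi u1)) (deg G (phi u0)) (w u1) (w u0) => d1 d0 w1 w0.
by clear; nia.
Qed.

Lemma one_side_inside : (forall z, deg G z <= deg G v) ->
  (forall C, clique G C -> #|C| <= #|W|) ->
  7 * #|W| ^ 2 + 4 < \sum_z deg G z + 9 * #|W| ->
  (forall a, G (phi u0) a -> a \in R) \/ (forall b, G v b -> b \in R).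
Proof.
move=> vmax cl big; have [hm _] := opt; have [inj phi_v _] := proj1 hm.
apply: contrapT => /not_orP[/existsNP[a] + /existsNP[b]].
move=> /not_implyP[xa /negP aR] /not_implyP[vb /negP bR].
have cR : #|R| = #|W| by rewrite card_imset // cardsT.
move: big; rewrite ltnNge -cR => /negP; apply.
apply: (@main_count V G R v (phi u0) a b) => //.
- by apply/imsetP => -[u _ e]; have := phi_v u; rewrite -e eqxx.
- exact: imset_f.
- move=> a' b' xa' a'R vb' b'R; apply: (hit_switch hm miss) => // u' e.
  by move: a'R; rewrite -e phi_in.
- by move=> p q a' b' pq pqT xa' a'R vb' b'R; apply: (hit_edge hm miss).
- exact: low_outside.
- by move=> C /cl; rewrite cR.
Qed.

End Optimal.

End Placement.

(** * Joins with a complete graph *)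

Section Join.
Variables (k : nat) (X : sgraph 'I_4).

Definition join_adj (a b : 'I_k + 'I_4) :=
  match a, b with
  | inl i, inl j => i != j
  | inr i, inr j => X i j
  | _, _ => true
  end.

Lemma join_sym : symmetric join_adj.
Proof. by move=> [i|i] [j|j] //=; [rewrite eq_sym | rewrite adj_sym]. Qed.

Lemma join_irr : irreflexive join_adj.
Proof. by move=> [i|i] /=; rewrite ?eqxx // adj_irr. Qed.

Definition join := SGraph join_sym join_irr.

End Join.

(** The complement of the star centred at [ord0]: a triangle and the isolated vertex [ord0]. *)
Definition claw_co_adj (i j : 'I_4) := [&& i != j, i != ord0 & j != ord0].

Lemma claw_co_sym : symmetric claw_co_adj.
Proof. by move=> i j; rewrite /claw_co_adj eq_sym [(i != _) && _]andbC. Qed.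

Lemma claw_co_irr : irreflexive claw_co_adj.
Proof. by move=> i; rewrite /claw_co_adj eqxx. Qed.

Definition claw_co := SGraph claw_co_sym claw_co_irr.

Definition path4_adj (i j : 'I_4) := (i.+1 == j :> nat) || (j.+1 == i :> nat).

Lemma path4_sym : symmetric path4_adj.
Proof. by move=> i j; rewrite /path4_adj orbC. Qed.

Lemma path4_irr : irreflexive path4_adj.
Proof. by move=> i; rewrite /path4_adj -(addn1 i) eqn_leq leqNgt addn1 ltnSn. Qed.

Definition path4 := SGraph path4_sym path4_irr.

(* With [t = k + 1] the second hypothesis is [2tn - t(t + 1) + 2 <= sum of degrees]. *)
Definition forces k X := forall (V : finType) (G : sgraph V),
  4 * k.+1 + 18 <= #|V| ->
  2 * k.+1 * #|V| + 2 <= \sum_x deg G x + k.+1 * k.+2 ->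
  exists G', same_deg G G' /\ contains G' (join k X).

Lemma clique_contains (V W : finType) (G : sgraph V) (F : sgraph W) (C : {set V}) :
  clique G C -> #|W| <= #|C| -> contains G F.
Proof.
move=> cl le; exists (fun u => enum_val (widen_ord le (enum_rank u))) => [u u'|u u' uu'].
  by move=> /enum_val_inj/(congr1 val) /= /val_inj/enum_rank_inj.
apply: cl; rewrite ?enum_valP // (inj_eq enum_val_inj).
apply: contraTneq uu' => /(congr1 val) /= /val_inj/enum_rank_inj ->.
by rewrite adj_irr.
Qed.

(** * Deleting a vertex and putting it back *)

Section Delete.
Variables (V : finType) (v : V).
Notation V' := {x : V | x != v}.

Lemma sum_delete (f : V -> nat) : \sum_x f x = f v + \sum_(x : V') f (val x).
Proof.
rewrite (bigD1 v) //=; congr (_ + _).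
rewrite (reindex_omap (val : V' -> V) insub) /= => [|x xv]; last by rewrite insubT.
by apply: eq_bigl => x; rewrite (valP x) valK eqxx.
Qed.

Definition delete_adj (G : sgraph V) : rel V' := fun x y => G (val x) (val y).

Lemma delete_sym G : symmetric (delete_adj G).
Proof. by move=> x y; rewrite /delete_adj adj_sym. Qed.

Lemma delete_irr G : irreflexive (delete_adj G).
Proof. by move=> x; rewrite /delete_adj adj_irr. Qed.

Definition delete G := SGraph (delete_sym G) (@delete_irr G).

Lemma deg_delete G (x : V') : deg G (val x) = G v (val x) + deg (delete G) x.
Proof. by rewrite !degE sum_delete adj_sym. Qed.

Lemma sum_deg_delete G : \sum_x deg G x = 2 * deg G v + \sum_x deg (delete G) x.
Proof.
rewrite sum_delete mul2n -addnn -addnA; congr (_ + _).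
rewrite (eq_bigr (fun x : V' => G v (val x) + deg (delete G) x)) => [|x _].
  by rewrite big_split /= [deg G v]degE sum_delete adj_irr.
exact: deg_delete.
Qed.

Variables (G : sgraph V) (G1 : sgraph V').

Definition undelete_adj : rel V := fun x y =>
  if (insub x : option V') is Some x' then
    if (insub y : option V') is Some y' then G1 x' y' else G x y
  else G x y.

Lemma undelete_sym : symmetric undelete_adj.
Proof.
by move=> x y; rewrite /undelete_adj; case: insub => [x'|]; case: insub => [y'|];
  rewrite adj_sym.
Qed.

Lemma undelete_irr : irreflexive undelete_adj.
Proof. by move=> x; rewrite /undelete_adj; case: insub => [x'|]; rewrite adj_irr. Qed.

Definition undelete := SGraph undelete_sym undelete_irr.

Lemma undelete_val (x y : V') : undelete (val x) (val y) = G1 x y.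
Proof. by rewrite /= /undelete_adj !valK. Qed.

Lemma undelete_v x : undelete v x = G v x.
Proof. by rewrite /= /undelete_adj insubN // negbK. Qed.

Lemma undelete_deg : same_deg (delete G) G1 -> same_deg G undelete.
Proof.
move=> sd x; have [->|xv] := eqVneq x v.
  by rewrite !degE; apply: eq_bigr => y _; rewrite undelete_v.
rewrite -[x]/(val (exist (fun z => z != v) x xv)) deg_delete sd.
rewrite !degE sum_delete [undelete _ v]adj_sym undelete_v; congr (_ + _).
by apply: eq_bigr => y _; rewrite undelete_val.
Qed.

End Delete.

Lemma forces_delete k X (V : finType) (G : sgraph V) (v : V) : forces k X ->
  4 * k.+2 + 18 <= #|V| ->
  2 * k.+2 * #|V| + 2 <= \sum_x deg G x + k.+2 * k.+3 ->
  exists G' phi, same_deg G G' /\ placed v (join k X) G' phi.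
Proof.
move=> forceX nV dV; have cV : #|{: {x : V | x != v}}| = #|V|.-1.
  by rewrite card_sig -(cardC1 v); apply: eq_card => x; rewrite !inE.
have [||G1 [sd1 [f inj edge]]] := forceX _ (delete v G).
- by rewrite cV; move: nV; clear; lia.
- rewrite cV; move: dV (deg_lt G v); rewrite (sum_deg_delete v).
  move: nV (deg G v) (\sum_x deg _ x); case: #|V| => // n /=.
  by clear; move=> nV d s; nia.
exists (undelete G G1), (fun u => val (f u)); split.
  exact: undelete_deg.
split=> [u u' /val_inj/inj //|u|u u' uu']; first exact: (valP (f u)).
by rewrite undelete_val; apply: edge.
Qed.

(** * The induction step *)

Lemma join_big_main k n S : 4 * k.+2 + 18 <= n ->
  2 * k.+2 * n + 2 <= S + k.+2 * k.+3 -> 7 * (k + 4) ^ 2 + 4 < S + 9 * (k + 4).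
Proof. by rewrite -mulnn; nia. Qed.

Lemma join_big_few k n S : 4 * k.+2 + 18 <= n ->
  2 * k.+2 * n + 2 <= S + k.+2 * k.+3 -> (k + 5) * (k + 5) + (n - (k + 5)) * k.+3 < S.
Proof. by nia. Qed.

Lemma join_big_dominating k n S : 4 * k.+2 + 18 <= n ->
  2 * k.+2 * n + 2 <= S + k.+2 * k.+3 -> k * n.-1 + (n - k) * k.+3 < S.
Proof. by nia. Qed.

(** The left side equals the degree sum (k+2)(2n-k-3) of the extremal graph for this step, which is
    2 below the threshold. *)
Lemma join_big2 k n S : 4 * k.+2 + 18 <= n ->
  2 * k.+2 * n + 2 <= S + k.+2 * k.+3 ->
  (k + 3) * (k + 3).-1 + 2 * (k.+2 * (n - (k + 3))) < S.
Proof. by nia. Qed.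

Lemma join_big3 k n S : 4 * k.+2 + 18 <= n ->
  2 * k.+2 * n + 2 <= S + k.+2 * k.+3 ->
  (k + 4) * (k + 4).-1 + 2 * (k.+1 * (n - (k + 4))) < S.
Proof. by nia. Qed.

(** Without the two extra units the left side can be attained by [S]; a nonadjacent pair in the core
    supplies them. *)
Lemma join_big4 k n S : 4 * k.+2 + 18 <= n ->
  2 * k.+2 * n + 2 <= S + k.+2 * k.+3 ->
  (k + 4) * (k + 4).-1 + 2 * (k.+2 * (n - (k + 4))) < S + 2.
Proof. by nia. Qed.

Section Step.
Variables (V : finType) (G : sgraph V) (v : V) (k : nat) (X : sgraph 'I_4).
Variables (wX : 'I_4 -> nat) (phi : 'I_k + 'I_4 -> V).

(** Only the order of the weights matters: 5 ranks the dominating roles above all roles in [X]. *)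
Definition join_weight (u : 'I_k + 'I_4) := if u is inr j then wX j else 5.

Hypotheses (wX_gt0 : forall j, 0 < wX j) (wX_lt5 : forall j, wX j < 5).
Hypotheses (nV : 4 * k.+2 + 18 <= #|V|)
  (dV : 2 * k.+2 * #|V| + 2 <= \sum_x deg G x + k.+2 * k.+3).
Hypothesis vmax : forall z, deg G z <= deg G v.
Hypothesis opt : optimal v (join k X) join_weight G phi.
Hypothesis free : ~ contains G (join k.+1 X).

Notation R := [set phi u | u : 'I_k + 'I_4].

Let phi_inj : injective phi. Proof. by case: opt => [[[]]]. Qed.
Let phi_v u : phi u != v. Proof. by case: opt => [[[]]]. Qed.
Let phi_edge u u' : join k X u u' -> G (phi u) (phi u').
Proof. by case: opt => [[[_ _ + _] _]]; apply. Qed.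

Let w_gt0 u : 0 < join_weight u.
Proof. by case: u => //= j. Qed.

Let cardW : #|{: 'I_k + 'I_4}| = k + 4.
Proof. by rewrite card_sum !card_ord. Qed.

Let cardR : #|R| = k + 4.
Proof. by rewrite card_imset ?cardsT. Qed.

Let vR : v \notin R.
Proof. by apply/imsetP => -[u _ e]; have := phi_v u; rewrite -e eqxx. Qed.

Let deg_in_R x u : (forall y, G x y -> y \in R) -> ~~ G x (phi u) -> deg G x <= k.+3.
Proof.
move=> sub nxu; have := cardsD1 (phi u) R; rewrite cardR imset_f // add1n addn4 => -[->].
apply: subset_leq_card; apply/subsetP => y; rewrite !inE => xy.
by rewrite sub // andbT; apply: contraTneq xy => ->.
Qed.

(** The other outcome of [one_side_inside] confines [v] to [R] minus a vertex; by maximality all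
    degrees are then at most k + 3, which is too few edges. *)
Let missing_inside u0 : ~~ G v (phi u0) -> forall y, G (phi u0) y -> y \in R.
Proof.
move=> miss; have [||//|v_in] := one_side_inside opt miss w_gt0 vmax.
- move=> C cl; rewrite cardW leqNgt; apply/negP => lt; apply: free.
  by apply: (clique_contains _ cl); rewrite card_sum !card_ord addSn.
- by rewrite cardW; apply: join_big_main dV.
have dv : deg G v <= k.+3.
  exact: deg_in_R v_in miss.
have := sum_deg_le (W := set0) (fun z => leq_trans (vmax z) dv) (fun z _ => leq_trans (vmax z) dv).
rewrite cards0 subn0 leqNgt => /negP; case.
by apply: leq_ltn_trans (join_big_few nV dV); clear; nia.
Qed.

Let deg_missing u0 : ~~ G v (phi u0) -> deg G (phi u0) <= k.+3.
Proof.
move=> miss; apply: (deg_in_R (u := u0)); last by rewrite adj_irr.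
exact: missing_inside.
Qed.

(** If a dominating role were missed, its degree of at most k + 3 would bound all degrees except
    those of [v] and the other k - 1 dominating vertices. *)
Let hitK i : G v (phi (inl i)).
Proof.
apply: contrapT => /negP miss.
pose W := v |: [set phi (inl i') | i' in [set~ i]].
have cW : #|W| = k.
  rewrite cardsU1 card_imset => [|i1 i2 /phi_inj[]//].
  rewrite cardsC1 card_ord (_ : v \notin _) ?add1n ?prednK //.
    exact: leq_ltn_trans (ltn_ord i).
  apply/imsetP => -[i' _ e].
  by have := phi_v (inl i'); rewrite -e eqxx.
have low z : z \notin W -> deg G z <= k.+3.
  move=> zW; apply: leq_trans (deg_missing miss).
  have [/imsetP[u _ ez]|zR] := boolP (z \in R).
    subst z; case: u zW => [i'|j] zW.
      have [->//|ne] := eqVneq i' i.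
      case/negP: zW; rewrite in_setU1 (imset_f (fun i => phi (inl i))) ?orbT //.
      by rewrite !inE.
    apply: (low_inside opt miss) => //= -[i'|j'] //= _ ne.
    by apply: contraNneq ne => ->.
  apply: (low_outside opt miss) => //; rewrite in_setU1 negb_or zR andbT.
  by apply: contraNneq zW => ->; rewrite setU11.
have := sum_deg_le (deg_lt G) low; rewrite cW leqNgt => /negP; apply.
exact: join_big_dominating dV.
Qed.

Definition slot (o : option 'I_4) := if o is Some j then phi (inr j) else v.

Let place (s : 'I_k + option 'I_4) := if s is inl i then phi (inl i) else
  if s is inr o then slot o else v.

Let place_inj : injective place.
Proof.
by move=> [i|[j|]] [i'|[j'|]] //= =>
    [/phi_inj[->]|/phi_inj|/eqP|/phi_inj|/phi_inj[->]|/eqP|/eqP|/eqP];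
  rewrite // 1?[v == _]eq_sym (negPf (phi_v _)).
Qed.

(* A realization of the larger join which reuses the placed one, with [v]
   ([None] in the domain) in the role of the new dominating vertex up to [s]. *)
Lemma rearranged (s : option 'I_4 -> option 'I_4) : injective s ->
  (forall j, G (slot (s None)) (slot (s (Some j)))) ->
  (forall j j', X j j' -> G (slot (s (Some j))) (slot (s (Some j')))) -> False.
Proof.
move=> s_inj dom XE; apply: free.
pose th (u : 'I_k.+1 + 'I_4) : 'I_k + option 'I_4 := match u with
  | inl i => if unlift ord0 i is Some i' then inl i' else inr (s None)
  | inr j => inr (s (Some j))
  end.
have KE i o : G (phi (inl i)) (slot o).
  by case: o => [j|] /=; [apply: phi_edge | rewrite adj_sym].
exists (fun u => place (th u)) => [u u' /place_inj|[i|j] [i'|j'] /=].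
- case: u u' => [i|j] [i'|j'] /=.
  + by do 2![case: unliftP => [?|] ->] => //= -[->].
  + by case: unliftP => [?|] _ // [/s_inj].
  + by case: unliftP => [?|] _ // [/s_inj].
  + by case=> /s_inj[->].
- case: unliftP => [l|] ->; case: unliftP => [l'|] -> //=.
  + by move=> ll'; apply: phi_edge; apply: contraNneq ll' => ->.
  + by rewrite adj_sym.
- by case: unliftP => [l|] _ _; [apply: KE | apply: dom].
- by case: unliftP => [l|] _ _; rewrite adj_sym; [apply: KE | apply: dom].
- exact: XE.
Qed.

Lemma some_missing : ~ forall j, G v (phi (inr j)).
Proof. by move=> hit; apply: (@rearranged id) => //= j j' jj'; apply: phi_edge. Qed.

(** * A missed role in [X] *)

Section Missing.
Variable j0 : 'I_4.
Hypothesis miss : ~~ G v (phi (inr j0)).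
Notation x j := (phi (inr j)).

Lemma missing_low j : wX j < wX j0 -> (forall i, X j i -> i != j0 -> X j0 i) ->
  deg G (x j) <= deg G (x j0).
Proof.
move=> w_lt role; apply: (low_inside opt miss) => // -[//|i] ji ne.
by apply: role => //; apply: contraNneq ne => ->.
Qed.

Lemma missing_deg m : #|[set j | G (x j0) (x j)]| <= m -> deg G (x j0) <= k + m.
Proof.
move=> le; apply: leq_trans (leq_add (leqnn k) le).
rewrite -[X in X + _]card_ord -cardsT.
rewrite -(card_imset (f := fun i => phi (inl i))); last by move=> i i' /phi_inj[].
rewrite -(card_imset (f := fun j => x j) [set j | _]); last by move=> i i' /phi_inj[].
apply: leq_trans (leq_card_setU _ _).1; apply: subset_leq_card.
apply/subsetP => y; rewrite inE => xy; have /imsetP[[i|j] _ ey] := missing_inside miss xy.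
  by rewrite ey inE imset_f.
rewrite ey inE; apply/orP; right.
by apply: (imset_f (fun j => x j)); rewrite inE -ey.
Qed.

(** With at most two neighbours outside [R], [v] has degree at most 2 + (k+3), and so has every
    vertex; those outside [v |: R] have degree at most k + 3. *)
Lemma missing_few_outside : 2 < #|[set b | G v b & b \notin R]|.
Proof.
rewrite ltnNge; apply/negP => le.
have dv : deg G v <= k + 5.
  rewrite /deg -(cardsID R) addnC (_ : k + 5 = 2 + k.+3); last by clear; lia.
  apply: leq_add.
    by apply: leq_trans le; apply: subset_leq_card; apply/subsetP => y; rewrite !inE andbC.
  have := cardsD1 (x j0) R; rewrite cardR imset_f // add1n addn4 => -[->].
  apply: subset_leq_card; apply/subsetP => y; rewrite !inE => /andP[vy ->].
  by rewrite andbT; apply: contraTneq vy => ->.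
have low z : z \notin v |: R -> deg G z <= k.+3.
  move=> zR; exact: leq_trans (low_outside opt miss w_gt0 zR) (deg_missing miss).
have := sum_deg_le (fun z => leq_trans (vmax z) dv) low.
rewrite cardsU1 vR cardR leqNgt => /negP; apply.
by have := join_big_few nV dV; rewrite (addnS k 4) (addnC 1) addn1.
Qed.

(* An edge at a missed vertex which the placement does not use can be traded
   for the missing edge, unless its other end sees all neighbours of [v]. *)
Lemma missing_extra j : G (x j0) (x j) -> ~~ X j0 j ->
  G v (x j) /\ deg G (x j0) < deg G (x j).
Proof.
move=> xj nX; have [hm _] := opt.
pose B := [set b | G v b & b \notin R].
have xB b : b \in B -> G (x j) b.
  rewrite inE => /andP[vb bR].
  have /orP[/eqP eb|//] : (x j == b) || G (x j) b.
    apply: (hit_switch hm miss xj vb bR) => -[i /phi_inj //|j' /phi_inj[->]].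
    exact: nX.
  by move: bR; rewrite -eb imset_f.
have B3 := missing_few_outside.
have [b bB] : exists b, b \in B by apply/card_gt0P; apply: leq_trans B3.
have vx : G v (x j).
  apply: contrapT => /negP nv; have := missing_inside nv (xB b bB).
  by move: bB; rewrite inE => /andP[_ /negPf->].
split=> //; apply: leq_ltn_trans (deg_missing miss) _.
have vn : v \notin B by rewrite inE adj_irr.
have dis : [disjoint v |: B & [set phi (inl i) | i : 'I_k]].
  rewrite disjoints_subset; apply/subsetP => y yB; rewrite inE.
  apply/imsetP => -[i _ ey]; move: yB; rewrite ey !inE (negPf (phi_v _)) /=.
  by rewrite imset_f ?andbF.
(* The neighbours of [x j] include [v], at least three vertices of [B] and the k dominating ones,
   which is one more than k + 3. *)
apply: leq_trans (_ : #|(v |: B) :|: [set phi (inl i) | i : 'I_k]| <= _); last first.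
  apply: subset_leq_card; apply/subsetP => y; rewrite inE [y \in [set _ | _]]inE.
  case/orP=> [/setU1P[->|/xB//]|/imsetP[i _ ->]]; first by rewrite adj_sym.
  exact: phi_edge.
rewrite cardsU; move: dis; rewrite -setI_eq0 => /eqP->; rewrite cards0 subn0.
rewrite cardsU1 vn card_imset => [|i i' /phi_inj[]//].
by rewrite card_ord; move: B3; rewrite -/B; clear; lia.
Qed.

Section Count.
Variables (J : {set 'I_4}) (d : nat).
Hypothesis lowJ : forall j, j \notin J -> deg G (x j) <= d.
Hypothesis low0 : deg G (x j0) <= d.

Definition core := v |: ([set phi (inl i) | i : 'I_k] :|: [set x j | j in J]).

Lemma card_core : #|core| = k + #|J|.+1.
Proof.
rewrite cardsU1 (_ : v \notin _) /=; last first.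
  rewrite inE; apply/orP => -[]/imsetP[i _ e]; first by have := phi_v (inl i); rewrite -e eqxx.
  by have := phi_v (inr i); rewrite -e eqxx.
rewrite cardsU [_ :&: _](_ : _ = set0); last first.
  apply/eqP; rewrite -subset0; apply/subsetP => y /setIP[/imsetP[i _ ->]].
  by move=> /imsetP[j _ /phi_inj].
rewrite cards0 subn0 !card_imset ?cardsT ?card_ord ?addnS //.
  by move=> j j' /phi_inj[].
by move=> i i' /phi_inj[].
Qed.

Lemma core_in j : j \in J -> x j \in core.
Proof. by move=> jJ; rewrite !inE; apply/or3P; apply: Or33; apply: imset_f. Qed.

Lemma core_low z : z \notin core -> deg G z <= d.
Proof.
move=> zW; have [/imsetP[[i|j] _ ez]|zR] := boolP (z \in R).
- by case/negP: zW; rewrite ez !inE imset_f ?orbT.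
- rewrite ez; apply: lowJ; apply: contraNN zW => jJ; rewrite ez; exact: core_in.
apply: leq_trans low0; apply: (low_outside opt miss) => //.
by rewrite in_setU1 negb_or zR andbT; apply: contraNneq zW => ->; rewrite setU11.
Qed.

Lemma core_count : \sum_z deg G z <=
  arcs G core core + 2 * (d * (#|V| - (k + #|J|.+1))).
Proof. by rewrite -card_core; apply: low_count; apply: core_low. Qed.

End Count.

(** All vertices outside the k + 3 of the core have degree at most k + 2, so the degree sum does not
    exceed that of the extremal graph. *)
Lemma no_low2 (J : {set 'I_4}) : #|J| = 2 -> (forall j, j \notin J -> deg G (x j) <= k.+2) ->
  deg G (x j0) <= k.+2 -> False.
Proof.
move=> cJ lowJ low0; have := core_count lowJ low0; have := arcs_inside G (core J).
rewrite card_core cJ => le1 le2; have := leq_trans le2 (leq_add le1 (leqnn _)).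
by rewrite leqNgt => /negP; apply; apply: join_big2 dV.
Qed.

Lemma no_low3 (J : {set 'I_4}) : #|J| = 3 -> (forall j, j \notin J -> deg G (x j) <= k.+1) ->
  deg G (x j0) <= k.+1 -> False.
Proof.
move=> cJ lowJ low0; have := core_count lowJ low0; have := arcs_inside G (core J).
rewrite card_core cJ => le1 le2; have := leq_trans le2 (leq_add le1 (leqnn _)).
by rewrite leqNgt => /negP; apply; apply: join_big3 dV.
Qed.

(** Here the count allows equality, but only if the core of k + 4 vertices is complete. *)
Lemma low3_edge (J : {set 'I_4}) p q : #|J| = 3 -> (forall j, j \notin J -> deg G (x j) <= k.+2) ->
  deg G (x j0) <= k.+2 -> p \in J -> q \in J -> p != q -> G (x p) (x q).
Proof.
move=> cJ lowJ low0 pJ qJ pq; apply: contrapT => /negP npq.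
have npq' : x p != x q by rewrite (inj_eq phi_inj); apply: contraNneq pq => -[->].
have := core_count lowJ low0.
have := arcs_inside_nonedge (core_in pJ) (core_in qJ) npq' npq.
have := join_big4 nV dV; rewrite card_core cJ.
by move: (_ * (k + 4).-1) (2 * (_ * (_ - _))) => m1 m2; clear; lia.
Qed.

End Missing.
Notation x j := (phi (inr j)).

Let card2C (i j : 'I_4) : i != j -> #|~: [set i; j]| = 2.
Proof. by move=> ij; rewrite cardsCs setCK cards2 ij card_ord. Qed.

Let card1C (i : 'I_4) : #|[set~ i]| = 3.
Proof. by rewrite cardsC1 card_ord. Qed.

(** A missed triangle role would outrank [c], hence not be joined to it by [missing_extra], and both
    would have degree at most k + 2. So only [c] is missed; either it has a neighbour among the
    triangle roles or its degree is too small. *)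
Lemma claw_case c : (forall i j, X i j = [&& i != j, i != c & j != c]) ->
  (forall j, wX j = if j == c then 1 else 2) -> False.
Proof.
move=> XE wE.
have hit j : j != c -> G v (x j).
  move=> jc; apply: contrapT => /negP miss.
  have low_c : deg G (x c) <= deg G (x j).
    apply: (missing_low miss) => [|i]; first by rewrite !wE eqxx (negPf jc).
    by rewrite XE eqxx andbF.
  have njc : ~~ G (x j) (x c).
    apply/negP => /(missing_extra miss)[]; first by rewrite XE eqxx !andbF.
    by rewrite ltnNge low_c.
  have degj : deg G (x j) <= k.+2.
    rewrite -(addn2 k); apply: (missing_deg miss); rewrite -[leqRHS](card2C jc).
    apply: subset_leq_card; apply/subsetP => i; rewrite !inE.
    by apply: contraL => /orP[]/eqP->; rewrite ?adj_irr.
  apply: (no_low2 miss (card2C jc)) => // i; rewrite !inE negbK.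
  by case/orP=> /eqP-> //; apply: leq_trans degj.
have miss : ~~ G v (x c).
  apply/negP => vc; apply: some_missing => j.
  by have [->|/hit] := eqVneq j c.
have [/existsP[j cj]|/existsPn none] := boolP [exists j, G (x c) (x j)].
  have jc : j != c by apply: contraTneq cj => ->; rewrite adj_irr.
  (* [x j] sees [x c], [v] and the rest of the triangle, so it becomes the dominating vertex, and
     [v], which sees that rest, takes its place. *)
  have nc i : i != j -> tperm None (Some j) (Some i) = Some i.
    by move=> ij; rewrite tpermD //; apply: contraNneq ij => -[->].
  apply: (@rearranged (tperm None (Some j))) => [|i|i i'].
  - exact: perm_inj.
  - rewrite tpermL; have [->|ij] := eqVneq i j; first by rewrite tpermR /= adj_sym hit.
    rewrite tpermD //; last by apply: contraNneq ij => -[->].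
    have [->|ic] := eqVneq i c; first by rewrite adj_sym.
    by apply: phi_edge; rewrite /= XE eq_sym ij jc.
  - rewrite XE => /and3P[ii' ic i'c].
    have [eij|ij] := eqVneq i j.
      by rewrite eij tpermR nc //= ?hit // -eij eq_sym.
    have [eij|i'j] := eqVneq i' j.
      by rewrite eij tpermR nc //= adj_sym hit.
    by rewrite !nc //; apply: phi_edge; rewrite /= XE ii' ic.
have degc : deg G (x c) <= k.+1.
  apply: leq_trans (_ : k + 0 <= _); last by rewrite addn0.
  apply: (missing_deg miss); rewrite leqn0 cards_eq0; apply/eqP/setP => j.
  by rewrite !inE (negPf (none j)).
apply: (no_low3 miss (card1C c)) => // j.
by rewrite !inE negbK => /eqP->.
Qed.

Record path_roles a b c d : Prop := PathRoles {
  path_cover : forall i, [\/ i = a, i = b, i = c | i = d];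
  path_uniq : uniq [:: a; b; c; d];
  path_edges : [/\ X a b, X b c & X c d];
  path_nonedges : [/\ ~~ X a c, ~~ X a d & ~~ X b d];
  path_weights : [/\ wX a = 1, wX b = 2, wX c = 2 & wX d = 1] }.

Lemma path_roles_rev a b c d : path_roles a b c d -> path_roles d c b a.
Proof.
case=> cov un [ab bc cd] [ac ad bd] [wa wb wc wd]; split=> //.
- by move=> i; case: (cov i) => ->; [apply: Or44|apply: Or43|apply: Or42|apply: Or41].
- by rewrite -(rev_uniq [:: a; b; c; d]) in un.
- by split; rewrite adj_sym.
- by split; rewrite adj_sym.
Qed.

(** [b] outranks the far end [d], since the only neighbour [c] of [d] in the path is also one of
    [b]. So a missed [b] is not joined to [d], and both have degree at most k + 2. *)
Lemma inner_hit a b c d : path_roles a b c d -> G v (x b).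
Proof.
case=> cov; rewrite /= !inE !negb_or => /and4P[/and3P[ab ac ad] /andP[bc bd] cd _].
case=> Xab Xbc Xcd [nXac nXad nXbd] [wa wb wc wd].
apply: contrapT => /negP miss.
have low_d : deg G (x d) <= deg G (x b).
  apply: (missing_low miss) => [|i]; first by rewrite wb wd.
  rewrite [X d i]adj_sym [X b i]adj_sym.
  case: (cov i) => -> //; rewrite ?(negPf nXad) ?eqxx ?adj_irr //.
  by rewrite [X c b]adj_sym.
have low_a : deg G (x a) <= deg G (x b).
  apply: (missing_low miss) => [|i]; first by rewrite wb wa.
  case: (cov i) => -> //; rewrite ?eqxx ?adj_irr ?(negPf nXac) ?(negPf nXad) //.
have nbd : ~~ G (x b) (x d).
  by apply/negP => /(missing_extra miss)[] //; rewrite ltnNge low_d.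
have degb : deg G (x b) <= k.+2.
  rewrite -(addn2 k); apply: (missing_deg miss); rewrite -[leqRHS](card2C bd).
  apply: subset_leq_card; apply/subsetP => i; rewrite !inE.
  by apply: contraL => /orP[]/eqP->; rewrite ?adj_irr.
apply: (no_low2 miss (card2C bd)) => // i; rewrite !inE negbK.
by case/orP=> /eqP-> //; apply: leq_trans degb.
Qed.

(** [y] becomes the dominating vertex and [p], [q], [r], [t] the path, in this order. *)
Lemma path_rearranged a b c d (y p q r t : option 'I_4) :
  path_roles a b c d -> uniq [:: y; p; q; r; t] ->
  [/\ G (slot y) (slot p), G (slot y) (slot q), G (slot y) (slot r) & G (slot y) (slot t)] ->
  [/\ G (slot p) (slot q), G (slot q) (slot r) & G (slot r) (slot t)] -> False.
Proof.
move=> [cov un4 _ [nXac nXad nXbd] _] un [yp yq yr yt] [pq qr rt].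
move: un4; rewrite /= !inE !negb_or => /and4P[/and3P[ab ac ad] /andP[bc bd] cd _].
pose old := [:: None; Some a; Some b; Some c; Some d].
have in_old o : o \in old.
  by case: o => [i|] //; case: (cov i) => ->; rewrite !inE eqxx ?orbT.
pose s o := nth None [:: y; p; q; r; t] (index o old).
have sN : s None = y by [].
have eqS i j : (Some i == Some j) = (i == j) by apply/eqP/eqP => [[]|->].
have sa : s (Some a) = p by rewrite /s /= eqS eqxx.
have sb : s (Some b) = q by rewrite /s /= !eqS (negPf ab) eqxx.
have sc : s (Some c) = r by rewrite /s /= !eqS (negPf ac) (negPf bc) eqxx.
have sd : s (Some d) = t by rewrite /s /= !eqS (negPf ad) (negPf bd) (negPf cd) eqxx.
apply: (@rearranged s) => [o o' /eqP|j|j j'].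
- have lt z : index z old < size [:: y; p; q; r; t] by have := in_old z; rewrite -index_mem.
  by rewrite (nth_uniq _ (lt o) (lt o') un) => /eqP e;
    rewrite -(nth_index None (in_old o)) e nth_index.
- by rewrite sN; case: (cov j) => ->; rewrite ?sa ?sb ?sc ?sd.
case: (cov j) => ->; case: (cov j') => ->;
  rewrite ?sa ?sb ?sc ?sd ?adj_irr ?(negPf nXac) ?(negPf nXad) ?(negPf nXbd) //;
  by rewrite [X _ _]adj_sym [G _ _]adj_sym ?(negPf nXac) ?(negPf nXad) ?(negPf nXbd).
Qed.

Lemma outer_hit a b c d : path_roles a b c d -> G v (x a).
Proof.
move=> pr; have vb := inner_hit pr; have vc := inner_hit (path_roles_rev pr).
have [cov] := pr; rewrite /= !inE !negb_or => /and4P[/and3P[ab ac ad] /andP[bc bd] cd _].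
case=> Xab Xbc Xcd [nXac nXad nXbd] [wa wb wc wd].
have sym (i j : 'I_4) : i != j -> j != i by rewrite eq_sym.
have [gab gbc gcd] : [/\ G (x a) (x b), G (x b) (x c) & G (x c) (x d)].
  by split; apply: phi_edge.
have eqS i j : (Some i == Some j) = (i == j) by apply/eqP/eqP => [[]|->].
apply: contrapT => /negP miss.
have [gac|ngac] := boolP (G (x a) (x c)).
  have [gvd|ngvd] := boolP (G v (x d)).
    (* [c] sees everything, and [v] replaces it between [b] and [d]. *)
    apply: (path_rearranged (y := Some c) (p := Some a) (q := Some b) (r := None)
      (t := Some d) pr).
    - by rewrite /= !inE !eqS !negb_or ab ad bd (sym _ _ ac) (sym _ _ bc) cd.
    - by split=> //=; rewrite adj_sym.
    - by split=> //=; rewrite adj_sym.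
  have ngad : ~~ G (x a) (x d).
    by apply: contra ngvd => gad; case: (missing_extra miss gad nXad).
  (* Both ends are missed and not joined to each other, so both have low degree. *)
  have two i j : i != j -> ~~ G v (x i) -> ~~ G (x i) (x j) -> deg G (x i) <= k.+2.
    move=> ij missi nij; rewrite -(addn2 k); apply: (missing_deg missi).
    rewrite -[leqRHS](card2C ij); apply: subset_leq_card; apply/subsetP => l.
    by rewrite !inE; apply: contraL => /orP[]/eqP->; rewrite ?adj_irr.
  apply: (no_low2 miss (card2C ad)); last exact: (two a d).
  move=> i; rewrite !inE negbK => /orP[]/eqP->; first exact: (two a d).
  by apply: (two d a); rewrite 1?eq_sym // adj_sym.
have [gad|ngad] := boolP (G (x a) (x d)).
  have [gvd _] := missing_extra miss gad nXad.
  have dega : deg G (x a) <= k.+2.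
    rewrite -(addn2 k); apply: (missing_deg miss); rewrite -[leqRHS](card2C ac).
    apply: subset_leq_card; apply/subsetP => i; rewrite !inE.
    by apply: contraL => /orP[]/eqP->; rewrite ?adj_irr.
  (* The only low role is [a], so the core with [b], [c], [d] must be complete; [b] can then
     dominate the path a, d, v, c. *)
  have gbd : G (x b) (x d).
    apply: (low3_edge miss (card1C a)) => //; rewrite ?inE 1?eq_sym //.
    by move=> i; rewrite !inE negbK => /eqP->.
  apply: (path_rearranged (y := Some b) (p := Some a) (q := Some d) (r := None)
    (t := Some c) pr).
  - by rewrite /= !inE !eqS !negb_or ad ac (sym _ _ ab) bc bd (sym _ _ cd).
  - by split=> //=; rewrite adj_sym.
  - by split=> //=; rewrite adj_sym.
have dega : deg G (x a) <= k.+1.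
  rewrite -(addn1 k); apply: (missing_deg miss); rewrite -[leqRHS](cards1 b).
  apply: subset_leq_card; apply/subsetP => i; rewrite !inE.
  by case: (cov i) => ->; rewrite ?adj_irr ?eqxx ?(negPf ngac) ?(negPf ngad).
apply: (no_low3 miss (card1C a)) => // i.
by rewrite !inE negbK => /eqP->.
Qed.

Lemma path_case a b c d : path_roles a b c d -> False.
Proof.
move=> pr; apply: some_missing => j; have [cov _ _ _ _] := pr.
have pr' := path_roles_rev pr.
by case: (cov j) => ->; [apply: outer_hit pr | apply: inner_hit pr
  | apply: inner_hit pr' | apply: outer_hit pr'].
Qed.

End Step.

Lemma forces_step k X (wX : 'I_4 -> nat) : (forall j, 0 < wX j) -> (forall j, wX j < 5) ->
  (forall (V : finType) (G : sgraph V) v phi,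
    4 * k.+2 + 18 <= #|V| -> 2 * k.+2 * #|V| + 2 <= \sum_x deg G x + k.+2 * k.+3 ->
    (forall z, deg G z <= deg G v) -> optimal v (join k X) (join_weight wX) G phi ->
    ~ contains G (join k.+1 X) -> False) ->
  forces k X -> forces k.+1 X.
Proof.
move=> w0 w5 step fX V G nV dV.
have [v0 _] : exists v : V, true.
  by move: nV; case: (pickP V) => [v|e]; [exists v | rewrite eq_card0].
case: (@arg_maxnP V v0 xpredT (deg G)) => // v _ vmax.
have [G1 [phi1 [sd1 pl1]]] := forces_delete v fX nV dV.
have [G2 [phi2 [sd2 opt]]] := exists_optimal (join_weight wX) pl1.
have sd := same_deg_trans sd1 sd2.
exists G2; split=> //; apply: contrapT => nc.
apply: (step V G2 v phi2) => // [|z]; last by rewrite -!sd; apply: vmax.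
by rewrite -(eq_bigr _ (fun x _ => sd x)).
Qed.

Lemma forces_claw_step k : forces k claw_co -> forces k.+1 claw_co.
Proof.
pose wX (j : 'I_4) := if j == ord0 then 1 else 2.
apply: (forces_step (wX := wX)) => [j|j|V G v phi nV dV vmax opt nc]; try by rewrite /wX; case: eqP.
apply: (claw_case _ _ nV dV vmax opt nc (c := ord0)) => //.
- by move=> j; rewrite /wX; case: eqP.
- by move=> j; rewrite /wX; case: eqP.
Qed.

Lemma forces_path_step k : forces k path4 -> forces k.+1 path4.
Proof.
pose wX (j : 'I_4) := if (j == 0 :> nat) || (j == 3 :> nat) then 1 else 2.
apply: (forces_step (wX := wX)) => [j|j|V G v phi nV dV vmax opt nc]; try by rewrite /wX; case: ifP.
pose o i (lt : i < 4) : 'I_4 := Ordinal lt.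
apply: (path_case _ _ nV dV vmax opt nc (a := @o 0 isT) (b := @o 1 isT)
  (c := @o 2 isT) (d := @o 3 isT)).
- by move=> j; rewrite /wX; case: ifP.
- by move=> j; rewrite /wX; case: ifP.
split=> //; case=> [[|[|[|[|//]]]] lt].
- by apply: Or41; apply: val_inj.
- by apply: Or42; apply: val_inj.
- by apply: Or43; apply: val_inj.
- by apply: Or44; apply: val_inj.
Qed.

(** * The base case *)

Definition edge_adj : rel bool := fun x y => x != y.

Lemma edge_sym : symmetric edge_adj.
Proof. by move=> x y; rewrite /edge_adj eq_sym. Qed.

Lemma edge_irr : irreflexive edge_adj.
Proof. by move=> x; rewrite /edge_adj eqxx. Qed.

Definition edge := SGraph edge_sym edge_irr.

Definition triangle (V : finType) (G : sgraph V) (t : V * V * V) :=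
  [/\ G t.1.1 t.1.2, G t.1.2 t.2 & G t.1.1 t.2].

Lemma clique_triangle (V : finType) (G : sgraph V) (C : {set V}) :
  clique G C -> 2 < #|C| -> exists t, triangle G t.
Proof.
move=> cl C3; have inC (i : 'I_3) : enum_val (widen_ord C3 i) \in C by apply: enum_valP.
have adjC (i j : 'I_3) : i != j ->
    G (enum_val (widen_ord C3 i)) (enum_val (widen_ord C3 j)).
  move=> ij; apply: cl => //; rewrite (inj_eq enum_val_inj).
  by apply: contraNneq ij => /(congr1 val) /= /val_inj ->.
pose o i (lt : i < 3) : 'I_3 := Ordinal lt.
pose e (i : 'I_3) := enum_val (widen_ord C3 i).
by exists (e (@o 0 isT), e (@o 1 isT), e (@o 2 isT)); split; apply: adjC.
Qed.

(** The induction step in miniature: an edge avoiding [v] is placed, and an optimal placement must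
    have both ends adjacent to [v]. *)
Lemma realize_triangle (V : finType) (G : sgraph V) : 22 <= #|V| ->
  2 * #|V| <= \sum_x deg G x -> exists G', same_deg G G' /\ exists t, triangle G' t.
Proof.
move=> nV dV.
have [v0 _] : exists v : V, true.
  by move: nV; case: (pickP V) => [v|e]; [exists v | rewrite eq_card0].
case: (@arg_maxnP V v0 xpredT (deg G)) => // v _ vmax.
(* If every vertex but [v] had degree at most 1, the degree sum would be at most 2(n-1). *)
have [z zv dz] : exists2 z, z != v & 1 < deg G z.
  apply: contrapT => no; have low z : z \notin [set v] -> deg G z <= 1.
    rewrite inE => zv; rewrite leqNgt; apply/negP => dz; apply: no; by exists z.
  have := low_count low; have := arcs_inside G [set v].
  by rewrite cards1; move: nV dV; clear; lia.
have [y yv zy] : exists2 y, y != v & G z y.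
  have /card_gt0P[y] : 0 < #|[set y | G z y] :\ v|.
    by move: dz; rewrite /deg (cardsD1 v); case: (_ \in _); clear; lia.
  by rewrite !inE => /andP[yv zy]; exists y.
have zy' : z != y by apply: contraTneq zy => ->; rewrite adj_irr.
have [|G' [phi [sd opt]]] :=
    @exists_optimal V bool v edge (fun=> 1) G (fun b => if b then z else y).
  split=> [[] [] // /eqP|[]|[] []] //=; rewrite ?(negPf zy') ?(negPf yv) //.
  - by rewrite eq_sym (negPf zy').
  - by rewrite adj_sym.
exists G'; split=> //; apply: contrapT => no.
have dV' : 2 * #|V| <= \sum_x deg G' x by rewrite -(eq_bigr _ (fun x _ => sd x)).
have vmax' x : deg G' x <= deg G' v by rewrite -!sd; apply: vmax.
have [inj phi_v ed] := proj1 (proj1 opt).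
have e01 : G' (phi true) (phi false) by apply: ed.
have [b miss] : exists b, ~~ G' v (phi b).
  apply: contrapT => nomiss; apply: no; exists (v, phi true, phi false).
  have hit b : G' v (phi b) by apply: contrapT => /negP n; apply: nomiss; exists b.
  by split=> //=; apply: hit.
pose R := [set phi b | b : bool].
have inR x : x \in R -> x != phi b -> x = phi (~~ b).
  move=> /imsetP[b' _ ->] ne; congr phi; move: ne; case: b b' {miss} => [] [] //; by rewrite eqxx.
have [|||v_in] := one_side_inside opt miss (fun=> isT) vmax'.
- by move=> C cl; rewrite card_bool leqNgt; apply/negP => /(clique_triangle cl).
- by rewrite card_bool; move: nV dV'; clear; lia.
- move=> b_in; have db : deg G' (phi b) <= 1.
    rewrite -(cards1 (phi (~~ b))); apply: subset_leq_card; apply/subsetP => x.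
    rewrite !inE => bx; rewrite (inR x (b_in x bx)) //.
    by apply: contraTneq bx => ->; rewrite adj_irr.
  have low x : x \notin [set v; phi (~~ b)] -> deg G' x <= 1.
    rewrite !inE negb_or => /andP[xv xb]; have [xR|xR] := boolP (x \in R).
      suff -> : x = phi b by [].
      by apply: contrapT => /eqP /(inR x xR) e; rewrite e eqxx in xb.
    apply: leq_trans db; apply: (low_outside opt miss) => //.
    by rewrite in_setU1 negb_or xv.
  have := low_count low; have := arcs_inside G' [set v; phi (~~ b)].
  by rewrite cards2 eq_sym phi_v; move: nV dV'; clear; lia.
have dv : deg G' v <= 1.
  rewrite -(cards1 (phi (~~ b))); apply: subset_leq_card; apply/subsetP => x.
  rewrite !inE => vx; rewrite (inR x (v_in x vx)) //.
  by apply: contraTneq vx => ->.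
have low z : deg G' z <= 1 := leq_trans (vmax' z) dv.
have := sum_deg_le (W := set0) low (fun z _ => low z).
by rewrite cards0; move: nV dV'; clear; lia.
Qed.

Lemma forces_claw0 : forces 0 claw_co.
Proof.
move=> V G nV dV; have [||G' [sd [[[x y] z] [/= xy yz xz]]]] := @realize_triangle V G.
- by move: nV; clear; lia.
- by move: dV; clear; lia.
exists G'; split=> //.
have [w ws] : exists w, w \notin [set x; y; z].
  have /card_gt0P[w] : 0 < #|~: [set x; y; z]|.
    rewrite cardsCs_sub subn_gt0; apply: leq_trans nV.
    rewrite -setUA cardsU1 cards2; by case: (_ \notin _); case: (_ != _).
  by rewrite inE; exists w.
move: ws; rewrite !inE !negb_or => /andP[/andP[wx wy] wz].
pose s := [:: w; x; y; z].
have s_uniq : uniq s.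
  have ne p q : G' p q -> p != q by move=> pq; apply: contraTneq pq => ->; rewrite adj_irr.
  by rewrite /= !inE !negb_or wx wy wz !ne.
exists (fun u : 'I_0 + 'I_4 => if u is inr j then nth w s j else w).
  move=> [[]//|i] [[]//|j] /eqP; rewrite nth_uniq // => /eqP/val_inj ->//.
move=> [[]//|i] [[]//|j] /=; rewrite /claw_co_adj.
by case: i j => [[|[|[|[|//]]]] ?] [[|[|[|[|//]]]] ?] //=; rewrite adj_sym.
Qed.

(** An edge leaving the triangle extends it to a path on four vertices. If there is none, some edge
    is disjoint from the triangle, and a switch connects the two. *)
Lemma forces_path0 : forces 0 path4.
Proof.
move=> V G nV dV; have [||G' [sd [[[x y] z] [/= xy yz xz]]]] := @realize_triangle V G.
- by move: nV; clear; lia.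
- by move: dV; clear; lia.
have fin (G1 : sgraph V) p q r t : [/\ G1 p q, G1 q r & G1 r t] -> p != r -> q != t ->
    p != t -> contains G1 (join 0 path4).
  move=> [pq qr rt] pr qt pt; pose s := [:: p; q; r; t].
  have s_uniq : uniq s.
    have ne i j : G1 i j -> i != j by move=> ij; apply: contraTneq ij => ->; rewrite adj_irr.
    by rewrite /= !inE !negb_or pr qt pt !ne.
  exists (fun u : 'I_0 + 'I_4 => if u is inr j then nth p s j else p).
    move=> [[]//|i] [[]//|j] /eqP; rewrite nth_uniq // => /eqP/val_inj ->//.
  move=> [[]//|i] [[]//|j] /=; rewrite /path4_adj.
  by case: i j => [[|[|[|[|//]]]] ?] [[|[|[|[|//]]]] ?] //=; rewrite adj_sym.
have ne i j : G' i j -> i != j by move=> ij; apply: contraTneq ij => ->; rewrite adj_irr.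
have sym (i j : V) : i != j -> j != i by rewrite eq_sym.
have dV' : 2 * #|V| <= \sum_x deg G' x.
  by rewrite -(eq_bigr _ (fun x _ => sd x)); move: dV; clear; lia.
pose T := [set x; y; z].
have cT : #|T| = 3.
  by rewrite /T -setUA cardsU1 cards2 !inE negb_or !ne.
have [[p [q [pT qT pq]]]|no_leave] := EM (exists p q, [/\ p \in T, q \notin T & G' p q]).
  exists G'; split=> //; move: qT; rewrite !inE !negb_or => /andP[/andP[qx qy] qz].
  move: pT; rewrite !inE -orbA => /or3P[]/eqP ep; subst p.
  - by apply: (fin G' q x y z); [split | | |]; rewrite // 1?adj_sym // ne.
  - by apply: (fin G' q y x z); [split | | |]; rewrite // 1?adj_sym // ne.
  - by apply: (fin G' q z x y); [split | | |]; rewrite // 1?adj_sym // ne // adj_sym.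
have [p [q [pT qT pq]]] : exists p q, [/\ p \notin T, q \notin T & G' p q].
  apply: contrapT => no; have low w : w \notin T -> deg G' w <= 0.
    move=> wT; rewrite leqn0 cards_eq0; apply/eqP/setP => u; rewrite !inE.
    apply/negP => wu; have [uT|uT] := boolP (u \in T).
      by apply: no_leave; exists u, w; rewrite adj_sym.
    by apply: no; exists w, u.
  have := low_count low; have := arcs_inside G' T; rewrite cT.
  by move: dV' nV; clear; lia.
have noT a b : a \in T -> b \notin T -> ~~ G' a b.
  by move=> aT bT; apply/negP => ab; apply: no_leave; exists a, b.
have [xT yT zT] : [/\ x \in T, y \in T & z \in T] by rewrite !inE !eqxx ?orbT.
have neT a b : a \in T -> b \notin T -> a != b by move=> aT bT; apply: contraNneq bT => <-.
(* The switch spares [x z] and [z y], so p, x, z, y is a path. *)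
have [||||||G1 [sd1 xp yq keep _]] := @switch V G' x y p q => //; try by [apply: neT | apply: noT].
exists G1; split; first exact: same_deg_trans sd sd1.
apply: (fin G1 p x z y).
- have nepl i j c d : i != c -> i != d -> ~~ epair i j c d.
    by rewrite /epair => /negPf-> /negPf->.
  have nepr i j c d : j != c -> j != d -> ~~ epair i j c d.
    by rewrite /epair => /negPf-> /negPf->; rewrite !andbF.
  have zx : z != x by apply: sym; apply: ne.
  have zy : z != y by apply: sym; apply: ne.
  split; first by rewrite adj_sym.
    by apply: keep => //; apply: nepr => //; apply: neT.
  by apply: keep; [rewrite adj_sym | apply: nepl | apply: nepl; apply: neT].
- by apply/sym/neT.
- exact: ne.
- by apply/sym/neT.
Qed.

Lemma forces_claw k : forces k claw_co.
Proof. by elim: k => [|k IH]; [apply: forces_claw0 | apply: forces_claw_step]. Qed.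

Lemma forces_path k : forces k path4.
Proof. by elim: k => [|k IH]; [apply: forces_path0 | apply: forces_path_step]. Qed.

(** * The value of sigma *)

Lemma contains_trans (V W U : finType) (G : sgraph V) (F : sgraph W) (E : sgraph U) :
  contains G F -> contains F E -> contains G E.
Proof.
move=> [f f_inj fE] [g g_inj gE]; exists (f \o g); first exact: inj_comp.
by move=> x y /gE/fE.
Qed.

(** [h] lists four vertices on which all edges of [F] come from [X]; the other k vertices are
    matched with the dominating ones. The bijection [g] runs from the join to [F], so its inverse is
    the embedding. *)
Lemma join_contains (k m : nat) (X : sgraph 'I_4) (F : sgraph 'I_m) (h : 'I_4 -> 'I_m) :
  k + 4 = m -> injective h ->
  (forall i j, i != j -> ~~ X i j -> ~~ F (h i) (h j)) -> contains (join k X) F.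
Proof.
move=> km h_inj nF; pose C := ~: [set h i | i : 'I_4].
have cC : k = #|C| by rewrite cardsCs_sub card_imset // !card_ord -km addnK.
pose g (u : 'I_k + 'I_4) := match u with
  | inl i => enum_val (cast_ord cC i) | inr j => h j end.
have gC i : g (inl i) \in C by apply: enum_valP.
have hC j : h j \notin C by rewrite inE negbK imset_f.
have g_inj : injective g.
  move=> [i|j] [i'|j'].
  - by move/enum_val_inj/cast_ord_inj->.
  - by move=> e; have := gC i; rewrite e (negPf (hC j')).
  - by move=> e; have := gC i'; rewrite -e (negPf (hC j)).
  - by move/h_inj->.
have [g' gK g'K] : bijective g.
  by apply: inj_card_bij => //; rewrite card_sum !card_ord km.
exists g' => [|x y]; first exact: can_inj g'K.
rewrite -{1}(g'K x) -{1}(g'K y); move: (g' x) (g' y) => [i|j] [i'|j'] //= xy.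
- by apply: contraTneq xy => ->; rewrite adj_irr.
- have jj' : j != j' by apply: contraTneq xy => ->; rewrite adj_irr.
  by apply: contraTT xy; apply: nF.
Qed.

(** A connected graph on four vertices has a spanning star or path, and these are the complements of
    [claw_co] and [path4]. *)
Lemma spanning_star_or_path (T : sgraph 'I_4) : (forall x y, connect T x y) ->
  exists2 s : 'I_4 -> 'I_4, injective s &
    (forall i j, i != j -> ~~ claw_co i j -> T (s i) (s j)) \/
    (forall i j, i != j -> ~~ path4 i j -> T (s i) (s j)).
Proof.
move=> conn; pose o i (lt : i < 4) : 'I_4 := Ordinal lt.
pose o0 := @o 0 isT; pose o1 := @o 1 isT; pose o2 := @o 2 isT; pose o3 := @o 3 isT.
have all4 (Q : 'I_4 -> Prop) : Q o0 -> Q o1 -> Q o2 -> Q o3 -> forall i, Q i.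
  move=> q0 q1 q2 q3 [[|[|[|[|//]]]] lt].
  - by rewrite (_ : Ordinal lt = o0) //; apply: val_inj.
  - by rewrite (_ : Ordinal lt = o1) //; apply: val_inj.
  - by rewrite (_ : Ordinal lt = o2) //; apply: val_inj.
  - by rewrite (_ : Ordinal lt = o3) //; apply: val_inj.
have injs (l : seq 'I_4) : uniq l -> size l = 4 -> injective (fun i : 'I_4 => nth o0 l i).
  by move=> un sz i j /eqP; rewrite nth_uniq ?sz // => /eqP/val_inj.
have star a b c d : uniq [:: a; b; c; d] -> T a b -> T a c -> T a d ->
    exists2 s : 'I_4 -> 'I_4, injective s &
    (forall i j, i != j -> ~~ claw_co i j -> T (s i) (s j)) \/
    (forall i j, i != j -> ~~ path4 i j -> T (s i) (s j)).
  move=> un ab ac ad; exists (fun i => nth o0 [:: a; b; c; d] i); first exact: injs.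
  by left; apply: (all4); apply: (all4) => //= _ _; rewrite adj_sym.
(* The complement of [path4] is the path 2, 0, 3, 1; the list sends it to a, b, c, d. *)
have path a b c d : uniq [:: b; d; a; c] -> T a b -> T b c -> T c d ->
    exists2 s : 'I_4 -> 'I_4, injective s &
    (forall i j, i != j -> ~~ claw_co i j -> T (s i) (s j)) \/
    (forall i j, i != j -> ~~ path4 i j -> T (s i) (s j)).
  move=> un ab bc cd; exists (fun i => nth o0 [:: b; d; a; c] i); first exact: injs.
  by right; apply: (all4); apply: (all4) => //= _ _; rewrite adj_sym.
(* Connectedness gives an edge across every cut, in a form that can be evaluated on the six
   adjacency bits. *)
have cross (P : pred 'I_4) x y : P x != P y ->
    [|| (P o0 != P o1) && T o0 o1, (P o0 != P o2) && T o0 o2, (P o0 != P o3) && T o0 o3,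
        (P o1 != P o2) && T o1 o2, (P o1 != P o3) && T o1 o3 | (P o2 != P o3) && T o2 o3].
  apply: contraNT; rewrite !negb_or !negb_and !negbK => /and5P[c01 c02 c03 c12 /andP[c13 c23]].
  have cl : closed T P.
    move=> a b; rewrite /in_mem /=; move: a b.
    suff half (a b : 'I_4) : a <= b -> T a b -> P a = P b.
      move=> a b ab; case: (leqP a b) => [/half|/ltnW/half]; first exact.
      by move=> Pba; rewrite Pba // adj_sym.
    move: a b; apply: (all4); apply: (all4) => //= _ ab;
      rewrite ?ab ?orbF in c01 c02 c03 c12 c13 c23; exact/eqP.
  by apply/eqP; apply: (closed_connect cl (conn x y)).
have s0 := cross (pred1 o0) o0 o1 isT; have s1 := cross (pred1 o1) o1 o0 isT.
have s2 := cross (pred1 o2) o2 o0 isT; have s3 := cross (pred1 o3) o3 o0 isT.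
have s01 := cross [pred i | (i == o0) || (i == o1)] o0 o2 isT.
have s02 := cross [pred i | (i == o0) || (i == o2)] o0 o1 isT.
have s03 := cross [pred i | (i == o0) || (i == o3)] o0 o1 isT.
rewrite /= in s0 s1 s2 s3 s01 s02 s03.
(* Each of the 64 adjacency patterns fails at one of the seven cuts or contains one of the four
   stars or twelve paths. *)
case e01: (T o0 o1); case e02: (T o0 o2); case e03: (T o0 o3);
case e12: (T o1 o2); case e13: (T o1 o3); case e23: (T o2 o3);
  first [by move: s0 s1 s2 s3 s01 s02 s03; rewrite e01 e02 e03 e12 e13 e23
  | by apply: (star o0 o1 o2 o3); rewrite // adj_sym
  | by apply: (star o1 o0 o2 o3); rewrite // adj_sym
  | by apply: (star o2 o0 o1 o3); rewrite // adj_sym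
  | by apply: (star o3 o0 o1 o2); rewrite // adj_sym
  | by apply: (path o0 o1 o2 o3); rewrite // adj_sym
  | by apply: (path o0 o1 o3 o2); rewrite // adj_sym
  | by apply: (path o0 o2 o1 o3); rewrite // adj_sym
  | by apply: (path o0 o2 o3 o1); rewrite // adj_sym
  | by apply: (path o0 o3 o1 o2); rewrite // adj_sym
  | by apply: (path o0 o3 o2 o1); rewrite // adj_sym
  | by apply: (path o1 o0 o2 o3); rewrite // adj_sym
  | by apply: (path o1 o0 o3 o2); rewrite // adj_sym
  | by apply: (path o1 o2 o0 o3); rewrite // adj_sym
  | by apply: (path o1 o3 o0 o2); rewrite // adj_sym
  | by apply: (path o2 o0 o1 o3); rewrite // adj_sym
  | by apply: (path o2 o1 o0 o3); rewrite // adj_sym].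
Qed.

(** * The extremal graph for the lower bound *)

Section Extremal.
Variables (t n : nat).
Hypothesis tn : t.+1 < n.

Definition extremal_adj : rel 'I_n := fun x y => (x != y) && ((x < t) || (y < t)).

Lemma extremal_sym : symmetric extremal_adj.
Proof. by move=> x y; rewrite /extremal_adj eq_sym orbC. Qed.

Lemma extremal_irr : irreflexive extremal_adj.
Proof. by move=> x; rewrite /extremal_adj eqxx. Qed.

Definition extremal := SGraph extremal_sym extremal_irr.

Let card_low : #|[set y : 'I_n | y < t]| = t.
Proof.
rewrite cardsE -sum1_card -(big_ord_widen n (fun=> 1)) ?sum1_card ?card_ord //.
by apply: ltnW; apply: ltnW.
Qed.

Lemma extremal_deg x : deg extremal x = if x < t then n.-1 else t.
Proof.
rewrite /deg /= /extremal_adj; case: ifP => xt.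
  rewrite -[in RHS](card_ord n) -(cardC1 x) cardsE.
  by apply: eq_card => y; rewrite [LHS]/in_mem /= !inE andbT eq_sym.
rewrite -[RHS]card_low; apply: eq_card => y; rewrite !inE.
by rewrite /= andb_idl // => yt; apply: contraFneq xt => ->.
Qed.

Lemma extremal_sum : \sum_x deg extremal x = t * n.-1 + (n - t) * t.
Proof.
rewrite (eq_bigr _ (fun x _ => extremal_deg x)).
rewrite (bigID (fun x : 'I_n => x < t)) /=.
rewrite (eq_bigr (fun=> n.-1)) => [|x ->//].
rewrite [X in _ + X](eq_bigr (fun=> t)) => [|x /negPf->//].
rewrite !sum_nat_const; congr (_ * _ + _ * _); first by rewrite -cardsE.
have := cardsCs_sub [set y : 'I_n | y < t]; rewrite card_low card_ord => <-.
by apply: eq_card => x; rewrite !inE.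
Qed.

(** The degrees determine [G]: [t] vertices see everything, and a vertex of degree [t] sees only
    those. Hence at least three of the t + 3 vertices of [F] land in an independent set. *)
Lemma extremal_contains m (G : sgraph 'I_n) (F : sgraph 'I_m) :
  degree_seq G = degree_seq extremal -> m = t + 3 -> contains G F ->
  exists a b c, [/\ a != b, b != c & a != c] /\ [/\ ~~ F a b, ~~ F b c & ~~ F a c].
Proof.
move=> eqd mt [f f_inj fE].
have peq : perm_eq [seq deg G x | x : 'I_n] [seq deg extremal x | x : 'I_n].
  by rewrite -(perm_sort geq) [sort _ _]eqd perm_sort.
pose D := [set x | deg G x == n.-1].
have cnt (K : sgraph 'I_n) d : count (pred1 d) [seq deg K x | x : 'I_n] =
    #|[set x | deg K x == d]|.
  rewrite count_map -sum1_count big_enum_cond -sum1_card.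
  by apply: eq_bigl => x; rewrite !inE.
have cD : #|D| = t.
  rewrite -cnt (seq.permP peq) cnt -[RHS]card_low; apply: eq_card => x.
  by rewrite !inE extremal_deg; case: ifP => //; rewrite ?eqxx // => _; lia.
have degD x : x \notin D -> deg G x = t.
  rewrite inE => xD; have : deg G x \in [seq deg extremal x | x : 'I_n].
    by rewrite -(perm_mem peq) map_f // mem_enum.
  by case/mapP=> y _; rewrite extremal_deg; case: ifP => // _ e; rewrite e eqxx in xD.
have Dadj x y : x \in D -> x != y -> G x y.
  rewrite inE => /eqP dx xy; have : [set z | G x z] = [set~ x].
    apply/eqP; rewrite eqEcard cardsC1 card_ord -/(deg G x) dx leqnn andbT.
    by apply/subsetP => z; rewrite !inE; apply: contraTneq => ->; rewrite adj_irr.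
  by move/setP/(_ y); rewrite !inE eq_sym xy.
have indep x y : x \notin D -> y \notin D -> ~~ G x y.
  move=> xD yD; have : D = [set z | G x z].
    apply/eqP; rewrite eqEcard cD -/(deg G x) degD // leqnn andbT.
    by apply/subsetP => z zD; rewrite inE adj_sym Dadj //; apply: contraNneq xD => <-.
  by move/setP/(_ y); rewrite inE (negPf yD) => <-.
pose U := [set u | f u \notin D].
have cU : 2 < #|U|.
  have : #|~: U| <= t.
    rewrite -cD -(card_imset _ f_inj); apply: subset_leq_card.
    by apply/subsetP => x /imsetP[u]; rewrite !inE negbK => uD ->.
  by have := cardsCs_sub U; rewrite [X in X - _]card_ord => ->; move: mt; clear; lia.
have inU (i : 'I_3) : f (enum_val (widen_ord cU i)) \notin D.
  by have := enum_valP (widen_ord cU i); rewrite inE.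
pose e (i : 'I_3) := enum_val (widen_ord cU i).
have e_inj : injective e by move=> i j /enum_val_inj/(congr1 val) /= /val_inj.
have nF i j : ~~ F (e i) (e j) by apply/negP => /fE; apply/negP; apply: indep; apply: inU.
pose o i (lt : i < 3) : 'I_3 := Ordinal lt.
exists (e (@o 0 isT)), (e (@o 1 isT)), (e (@o 2 isT)); split.
  by split; rewrite (inj_eq e_inj).
by split; apply: nF.
Qed.

End Extremal.

Lemma complete_minus_nonadj k m (f : 'I_k -> 'I_m) (H : sgraph 'I_k) x y :
  x != y -> ~~ complete_minus f H x y -> exists u u', [/\ H u u', f u = x & f u' = y].
Proof.
rewrite /= /complete_minus_adj => ->; rewrite negbK => /existsP[u /existsP[u']].
by case/and3P=> uu' /eqP fu /eqP fu'; exists u, u'.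
Qed.

Lemma sumn_degree_seq n (G : sgraph 'I_n) : sumn (degree_seq G) = \sum_x deg G x.
Proof. by rewrite (perm_sumn (permEl (perm_sort _ _))) sumnE big_map big_enum. Qed.

Lemma size_degree_seq n (G : sgraph 'I_n) : size (degree_seq G) == n.
Proof. by rewrite size_sort size_map -cardE card_ord. Qed.

Lemma same_degree_seq n (G G' : sgraph 'I_n) : same_deg G G' -> degree_seq G = degree_seq G'.
Proof. by move=> sd; congr sort; apply: eq_map. Qed.

(** The right side, the degree sum of the extremal graph, is exactly l - 2. *)
Lemma lower_arith t n l m : t.+2 < n -> l + t.+1 * t.+2 = 2 * t.+1 * n + 2 ->
  m.+2 <= l -> m <= t.+1 * n.-1 + (n - t.+1) * t.+1.
Proof.
move=> tn; have [d ->] : exists d, n = t.+1 + d.+1 by exists (n - t.+2); lia.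
by rewrite addKn addnS /= => lE ml; lia.
Qed.

Theorem theorem1p3 (r k n : nat) (hr : 3 <= r) (hk : 4 <= k <= r + 1)
    (hn : 4 * r + 10 <= n)
    (H : sgraph 'I_k)
    (Htree : exists2 T : sgraph 'I_4, is_tree T & contains H T)
    (HC3 : ~ has_cycle H 3)
    (f : 'I_k -> 'I_(r + 1)) (f_inj : injective f) :
  sigma (complete_minus f H) n = (r - 1) * (2 * n - r) - 2 * (n - r).
Proof.
set F := complete_minus f H; set l := (r - 1) * _ - _.
have [t er] : exists t, r = t.+3 by exists (r - 3); lia.
have lE : l + t.+1 * t.+2 = 2 * t.+1 * n + 2.
  by rewrite /l er; move: hn; rewrite er; clear; nia.
have l_even : ~~ odd l.
  have /(congr1 odd) := lE; rewrite -mulnA addn2 mul2n !oddS negbK odd_double oddD.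
  by rewrite [odd (_ * _)]oddM !oddS negbK andNb addbF => ->.
have upper : sigma_bound F n l.
  move=> p [G Gp] lp.
  have [s s_inj sT] : exists2 s : 'I_4 -> 'I_(r + 1), injective s &
      (forall i j, i != j -> ~~ claw_co i j -> ~~ F (s i) (s j)) \/
      (forall i j, i != j -> ~~ path4 i j -> ~~ F (s i) (s j)).
    case: Htree => T [conn _] [g g_inj gH]; have [s s_inj sT] := spanning_star_or_path conn.
    have nF i j : T (s i) (s j) -> ~~ F (f (g (s i))) (f (g (s j))).
      move=> ij; rewrite /= /complete_minus_adj negb_and !negbK; apply/orP; right.
      by apply/existsP; exists (g (s i)); apply/existsP; exists (g (s j)); rewrite gH ?eqxx.
    exists (fun i => f (g (s i))) => [i j /f_inj/g_inj/s_inj //|].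
    by case: sT => sT; [left|right] => i j ij nX; apply: nF; apply: sT.
  have realize X : forces t X -> (forall i j, i != j -> ~~ X i j -> ~~ F (s i) (s j)) ->
      potentially F p.
    move=> fX nF; have [||G' [sd cG']] := fX _ G.
    - by rewrite card_ord; move: hn; rewrite er; clear; lia.
    - rewrite card_ord -sumn_degree_seq Gp; move: lp lE; clear; lia.
    exists G'; first by rewrite /realizes -(same_degree_seq sd).
    apply: contains_trans cG' _; apply: join_contains s_inj nF.
    by rewrite er; clear; lia.
  by case: sT; apply: realize; [apply: forces_claw | apply: forces_path].
have lower m : ~~ odd m -> sigma_bound F n m -> l <= m.
  move=> m_even bound; rewrite leqNgt; apply/negP => ml.
  have tn : t.+2 < n by move: hn; rewrite er; clear; lia.
  pose G0 := extremal t.+1 n; pose p0 := Tuple (size_degree_seq G0).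
  have [||G Gp cG] := bound p0; first by exists G0.
    rewrite /= sumn_degree_seq extremal_sum //.
    (* Both numbers are even, so a strict inequality leaves a gap of 2. *)
    have ml2 : m.+2 <= l.
      by rewrite ltn_neqAle ml andbT; apply: contraNneq l_even => <-; rewrite /= m_even.
    exact: lower_arith tn lE ml2.
  have rt : r + 1 = t.+1 + 3 by rewrite er; clear; lia.
  have [a [b [c [[ab bc ac] [nab nbc nac]]]]] := extremal_contains tn Gp rt cG.
  (* Each nonadjacent pair is the image of an edge of [H]; injectivity of [f] makes the three edges
     share their ends, giving a triangle. *)
  have [x [y [xy fx fy]]] := complete_minus_nonadj ab nab.
  have [y' [z [yz fy' fz]]] := complete_minus_nonadj bc nbc.
  have [x' [z' [xz fx' fz']]] := complete_minus_nonadj ac nac.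
  have ey : y' = y by apply: f_inj; rewrite fy.
  have ex : x' = x by apply: f_inj; rewrite fx.
  have ez : z' = z by apply: f_inj; rewrite fz.
  subst x' y' z'; apply: HC3; exists [:: x; y; z] => //.
  have ne u w : H u w -> u != w by move=> uw; apply: contraTneq uw => ->; rewrite adj_irr.
  by rewrite /ucycle /= xy yz adj_sym xz !inE negb_or !ne.
rewrite /sigma; case: ex_minnP => m /andP[m_even /asboolP m_bound] m_min.
apply/eqP; rewrite eqn_leq lower // andbT m_min // l_even.
exact/asboolP.
Qed.
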